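(* Let $G$ be a finite group. Then $\Delta(G)$ is a block square if and only if, up to an abelian direct factor, $G=A\times B$ where $A$ and $B$ are $\mathcal{D}$-groups of coprime orders (that is, if and only if $G = A\times B\times C$ for some subgroups $A,B,C$ of $G$ such that $C$ is abelian, possibly trivial, and $A$ and $B$ are $\mathcal{D}$-groups with $\gcd(|A|,|B|)=1$).
   Context: All groups are finite. For a finite group $G$ and $x\in G$, the conjugacy class of $x$ in $G$ is $x^G$, and its size is $|x^G|=|G:\mathbf{C}_G(x)|$. The center of $G$ is denoted $\mathbf{Z}(G)$. Prime graph on class sizes: $\Delta(G)$ is the simple undirected graph whose vertices are the prime numbers dividing some conjugacy class size of $G$, and in which two distinct vertices $p,q$ are adjacent if and only if $pq$ divides some conjugacy class size of $G$. Block square: a graph is a block square if its vertex set can be written as a union of four pairwise disjoint, non-empty subsets $\pi_1,\pi_2,\pi_3,\pi_4$ such that no vertex in $\pi_1$ is adjacent to any vertex in $\pi_4$, no vertex in $\pi_2$ is adjacent to any vertex in $\pi_3$, and there exist vertices in both $\pi_1$ and $\pi_4$ that are adjacent to vertices in $\pi_2$ and in $\pi_3$; that is, for each $i\in\{1,4\}$ and each $j\in\{2,3\}$ there is at least one edge between a vertex of $\pi_i$ and a vertex of $\pi_j$. $\mathcal{D}$-group: a finite group $H$ is a $\mathcal{D}$-group if $H=MN$ where $M\unlhd H$ and $N\leqslant H$ are abelian subgroups of coprime orders, $\mathbf{Z}(H)\leqslant N$, and the factor group $H/\mathbf{Z}(H)$ is a Frobenius group with kernel $M\mathbf{Z}(H)/\mathbf{Z}(H)$.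 *)

(* Defs.v *)
From mathcomp Require Import all_boot all_fingroup all_solvable.

Set Implicit Arguments.
Unset Strict Implicit.
Unset Printing Implicit Defensive.

Local Open Scope group_scope.

(* A simple graph is given by its vertices V : {pred T} and adjacency e : rel T. *)

Definition has_edge (T : eqType) (e : rel T) (A B : {pred T}) : Prop :=
  exists x y, [/\ x \in A, y \in B & e x y].

Definition disjoint_preds (T : eqType) (A B : {pred T}) : Prop :=
  forall x, ~ (x \in A /\ x \in B).

Definition nonempty_pred (T : eqType) (A : {pred T}) : Prop :=
  exists x, x \in A.

Definition block_square (T : eqType) (V : {pred T}) (e : rel T) : Prop :=
  exists pi1 pi2 pi3 pi4 : {pred T},
    [/\ forall x, (x \in V) = [|| x \in pi1, x \in pi2, x \in pi3 | x \in pi4],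
        [/\ nonempty_pred pi1, nonempty_pred pi2,
            nonempty_pred pi3 & nonempty_pred pi4],
        [/\ disjoint_preds pi1 pi2, disjoint_preds pi1 pi3 &
            disjoint_preds pi1 pi4] /\
        [/\ disjoint_preds pi2 pi3, disjoint_preds pi2 pi4 &
            disjoint_preds pi3 pi4],
        ~ has_edge e pi1 pi4 /\ ~ has_edge e pi2 pi3 &
        [/\ has_edge e pi1 pi2, has_edge e pi1 pi3,
            has_edge e pi4 pi2 & has_edge e pi4 pi3]].

Section ClassSizeGraph.

Variables (gT : finGroupType) (G : {set gT}).

Definition Delta_vertex : {pred nat} :=
  [pred p | prime p && [exists x in G, p %| #|x ^: G|]].

Definition Delta_adj : rel nat :=
  [rel p q | [&& p \in Delta_vertex, q \in Delta_vertex, p != q &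
                 [exists x in G, (p * q)%N %| #|x ^: G|]]].

Lemma Delta_adj_irr : irreflexive Delta_adj.
Proof. by move=> p; apply/negP; case/and4P=> _ _; rewrite eqxx. Qed.

Lemma Delta_adj_sym : symmetric Delta_adj.
Proof. by move=> p q; apply/and4P/and4P; case=> Vp Vq; rewrite eq_sym mulnC; split. Qed.

End ClassSizeGraph.

Definition D_group (gT : finGroupType) (H : {group gT}) : Prop :=
  exists M N : {group gT},
    [/\ M * N = H,
        M <| H /\ N \subset H,
        [/\ abelian M, abelian N & coprime #|M| #|N|],
        'Z(H) \subset N &
        [Frobenius H / 'Z(H) with kernel (M * 'Z(H)) / 'Z(H)]].

(* Main.v *)
Require Import Defs.
From mathcomp Require Import all_boot all_fingroup all_solvable.

Set Implicit Arguments.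
Unset Strict Implicit.
Unset Printing Implicit Defensive.

Local Open Scope group_scope.

(** Why the theorem holds.

    Write rho, sigma, alpha, beta for pi1, pi4, pi2, pi3.  Every class size of G
    avoids rho or avoids sigma, and avoids alpha or avoids beta; call x bad for
    a set of primes when its class size is divisible by one of them.  The
    conditions are unchanged when rho and sigma, or alpha and beta, are
    exchanged, so a class of maximal size may be supposed to avoid rho and
    alpha; its size is then a tau-number, where tau is the union of sigma and
    beta.

    The first idea is that, C being that class of maximal size, there is a
    normal subgroup S whose order divides |C| and which contains [x, g] for all
    g in G whenever the class size of x is coprime to |C|
    ([max_class_stabiliser]).  Since S is a tau-group, every element whose
    class size is a tau'-number lies, up to a central factor, in the centre of
    O_tau(G) ([small_class_central]).  In particular an element that is bad for
    rho and for alpha yields a pivot x in Z(O_tau(G)).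

    The second idea is a count ([unique_centralised_conjugate]): if every
    element outside a proper normal subgroup F centralises a Sylow p-subgroup,
    then N_G(P) = C_G(P), and the centraliser of any p-bad element is contained
    in F.  It applies to p in rho and F = C_G(O_sigma(G)): an element that moves
    O_sigma(G) is bad for sigma, hence not for rho.  It applies likewise to
    alpha and C_G(O_beta(G)).  As the pivot is bad on both sides, its
    centraliser is the intersection of these two normal subgroups, O_sigma(G)
    and O_beta(G) are abelian, and their product is the normal Hall tau-subgroup
    O_tau(G) ([pivot_centE], [tau_core_Hall]).  Its complement R is abelian
    ([complement_abelian]); its rho-part N1 acts on O_sigma(G) alone, its
    alpha-part N2 on O_beta(G) alone, and by the count these actions are fixed
    point free up to the centre of G.  Hence [O_sigma(G), N1] N1 and
    [O_beta(G), N2] N2 are D-groups, and what remains is central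
    ([pivot_decomposition]).

    Conversely the class sizes of a D-group MN are 1, |M| and |N : Z|
    ([D_group_class_sizes]), and class sizes multiply in a direct product, so
    the graph of A x B x C is read off from four pairwise coprime numbers
    ([decomposes_block_square]). *)

(** * Class sizes and centralisers *)

Section Groups.

Variable gT : finGroupType.
Implicit Types (G H K M N P Q F S : {group gT}) (x y z : gT) (p : nat).
Implicit Types (pi rho sigma alpha beta tau : nat_pred).

Lemma class_size_gt0 G x : 0 < #|x ^: G|.
Proof. by rewrite -index_cent1 indexg_gt0. Qed.

Lemma dvdn_class_size G x y :
  'C_G[x] \subset 'C_G[y] -> #|y ^: G| %| #|x ^: G|.
Proof. by move=> sCxCy; rewrite -!index_cent1 indexgS. Qed.

Lemma dvdn_class_normal G N x :
  N <| G -> x \in G -> #|N : 'C[x]| %| #|x ^: G|.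
Proof.
move=> /andP[sNG nNG] Gx; rewrite -index_cent1.
have nNC: 'C_G[x] \subset 'N(N) by rewrite subIset ?nNG.
have ->: #|N : 'C[x]| = #|'C_G[x] <*> N : 'C_G[x]|.
  have eqI: N :&: 'C_G[x] = N :&: 'C[x] by rewrite setIA (setIidPl sNG).
  by rewrite norm_joinEl // indexMg -[RHS]indexgI /= eqI indexgI.
by rewrite indexSg ?joing_subl // join_subG subsetIl.
Qed.

Lemma class_good_Sylow G x p :
  p^'.-nat #|x ^: G| -> exists2 Q : {group gT}, p.-Sylow(G) Q & Q \subset 'C[x].
Proof.
rewrite -index_cent1 => p'x; have [Q sylQ] := Sylow_exists p 'C_G[x].
have [sQC pQ p'Q] := and3P sylQ; exists Q; last first.
  by apply: subset_trans sQC (subsetIr _ _).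
rewrite /pHall pQ (subset_trans sQC) ?subsetIl //=.
by rewrite -(Lagrange_index (subsetIl G 'C[x])) // pnatM p'x.
Qed.

Lemma Sylow_class_good G Q x p :
  p.-Sylow(G) Q -> Q \subset 'C[x] -> p^'.-nat #|x ^: G|.
Proof.
case/and3P=> sQG _ p'Q cQx; rewrite -index_cent1.
by apply: pnat_dvd p'Q; rewrite indexgS // subsetI sQG.
Qed.

(** * Elements outside a normal subgroup *)

(** Count the pairs formed by an element x outside F and a conjugate of P that
    x centralises. There are |G : N_G(P)| * |C_G(P) - F| of them, and this is
    at most |G - F| because C_G(P) is contained in N_G(P) and C_G(P) F in G.
    By hypothesis it is also at least |G - F|, so all these inequalities are
    equalities, and each x outside F centralises exactly one conjugate of P.
    An element that commutes with such an x fixes this conjugate, so lies in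
    its normaliser, which is its centraliser. *)
Lemma unique_centralised_conjugate G P F :
    P \subset G -> F <| G -> F \proper G ->
    (forall x, x \in G :\: F -> exists2 h, h \in G & P :^ h \subset 'C[x]) ->
  [/\ 'N_G(P) = 'C_G(P), 'C_G(P) * F = G &
      forall y, y \in G -> ~~ ('C_G[y] \subset F) ->
      exists2 h, h \in G & P :^ h \subset 'C[y]].
Proof.
move=> sPG nsFG prFG cover.
have [sFG nFG] := andP nsFG.
pose Om := P :^: G.
pose c x := #|[set Q in Om | Q \subset 'C[x]]|.
have c_gt0 x : x \in G :\: F -> 0 < c x.
  case/cover=> h Gh cPhx; apply/card_gt0P; exists (P :^ h).
  by rewrite inE cPhx andbT; apply/imsetP; exists h.
have sum_c : \sum_(x in G :\: F) c x = (#|Om| * #|'C_G(P) :\: F|)%N.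
  transitivity (\sum_(Q in Om) #|[set x in G :\: F | Q \subset 'C[x]]|).
    rewrite (eq_bigr (fun x => \sum_(Q in Om) (Q \subset 'C[x]))); last first.
      move=> x _; rewrite /c -sum1_card -big_mkcondr /=.
      by apply: eq_bigl => Q; rewrite inE.
    rewrite exchange_big /=; apply: eq_bigr => Q _.
    rewrite -sum1_card -big_mkcondr /=.
    by apply: eq_bigl => x; rewrite [RHS]inE.
  rewrite -sum_nat_const; apply: eq_bigr => _ /imsetP[h Gh ->].
  rewrite -[in RHS](cardJg _ h) conjDg conjIg -centJ (normsP nFG h Gh).
  rewrite (conjGid Gh).
  apply: eq_card => x; rewrite !inE sub_cent1 [x \in 'C(_)]/=.
  by rewrite andbC [(_ \notin _) && _]andbC; do !case: (_ \in _).
have cardOm : (#|Om| * #|'N_G(P)| = #|G|)%N.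
  by rewrite card_conjugates mulnC Lagrange ?subsetIl.
have sCN : 'C_G(P) \subset 'N_G(P) by rewrite setIS ?cent_sub.
have le_cN := subset_leq_card sCN.
have cardCF : (#|'C_G(P)| * #|F| = #|'C_G(P) * F|%g * #|'C_G(P) :&: F|)%N.
  exact: mul_cardG.
have sCFG : 'C_G(P) * F \subset G by rewrite mul_subG ?subsetIl.
have le_CF := subset_leq_card sCFG.
have cardCD : (#|'C_G(P) :\: F| + #|'C_G(P) :&: F| = #|'C_G(P)|)%N.
  by rewrite addnC cardsID.
have cardGD : (#|G :\: F| + #|F| = #|G|)%N.
  by rewrite addnC -(cardsID F G) (setIidPr sFG).
have le_sum : #|G :\: F| <= \sum_(x in G :\: F) c x.
  by rewrite -sum1_card; apply: leq_sum => x /c_gt0.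
have GD_gt0 : 0 < #|G :\: F|.
  have [_ [x Gx F'x]] := properP prFG.
  by apply/card_gt0P; exists x; rewrite inE F'x Gx.
have Om_gt0 : 0 < #|Om| by rewrite card_conjugates indexg_gt0.
move: le_sum; rewrite sum_c => le_sum.
have G_gt0 := cardG_gt0 G.
(* This is |C_G(P) F| <= |G|, written with differences in place of indices. *)
have le1 : (#|'C_G(P) :\: F| * #|G| <= #|'C_G(P)| * #|G :\: F|)%N.
  rewrite -(leq_add2r (#|'C_G(P) :&: F| * #|G|)) -mulnDl cardCD -{1}cardGD.
  rewrite mulnDr leq_add2l cardCF mulnC leq_mul2l.
  by rewrite le_CF orbT.
have le2 : (#|G| * #|G :\: F| <= #|Om| * (#|'C_G(P)| * #|G :\: F|))%N.
  apply: leq_trans (_ : #|Om| * (#|'C_G(P) :\: F| * #|G|) <= _)%N.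
    by rewrite mulnA mulnC leq_mul2r le_sum orbT.
  by rewrite leq_mul2l le1 orbT.
have eq_cN : #|'C_G(P)| = #|'N_G(P)|.
  apply/eqP; rewrite eqn_leq le_cN /=.
  by move: le2; rewrite mulnA leq_pmul2r // -cardOm leq_pmul2l.
have defN : 'N_G(P) = 'C_G(P).
  by apply/esym/eqP; rewrite eqEcard sCN eq_cN /=.
have eq1 : (#|Om| * #|'C_G(P) :\: F| = #|G :\: F|)%N.
  apply/eqP; rewrite eqn_leq le_sum andbT -(leq_pmul2r G_gt0) -mulnA.
  rewrite [X in _ <= X]mulnC -[in X in _ <= X]cardOm -eq_cN -mulnA.
  by rewrite leq_mul2l le1 orbT.
have defG : 'C_G(P) * F = G.
  have le3 : (#|'C_G(P)| * #|G :\: F| <= #|'C_G(P) :\: F| * #|G|)%N.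
    by rewrite -(leq_pmul2l Om_gt0) !mulnA eq1 eq_cN cardOm mulnC.
  apply/eqP; rewrite eqEcard sCFG /=.
  rewrite -(@leq_pmul2r #|'C_G(P) :&: F|) ?cardG_gt0 // -cardCF.
  rewrite -(leq_add2l (#|'C_G(P)| * #|G :\: F|)) -mulnDr cardGD.
  by rewrite -cardCD [leqRHS]mulnDl [(#|G| * _)%N]mulnC leq_add2r cardCD.
(* The count is exact: k centralises a single conjugate Q of P, which y then
   normalises because y commutes with k. *)
split=> // y Gy /subsetPn[k /setIP[Gk cyk] F'k].
have DFk : k \in G :\: F by rewrite inE F'k.
have c_k : c k = 1%N.
  apply/eqP; rewrite eqn_leq c_gt0 // andbT.
  rewrite -(leq_add2r (\sum_(x in G :\: F :\ k) 1)).
  have -> : (1 + \sum_(x in G :\: F :\ k) 1 = #|G :\: F|)%N.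
    by rewrite sum1_card [in RHS](cardsD1 k) DFk.
  rewrite -eq1 -sum_c [leqRHS](big_setD1 k) //= leq_add2l.
  by apply: leq_sum => x /setD1P[_ /c_gt0].
case/eqP/cards1P: c_k => Q defQ.
have : Q \in [set Q in Om | Q \subset 'C[k]] by rewrite defQ set11.
rewrite inE => /andP[/imsetP[h Gh defPh] cQk].
exists h => //; rewrite -defPh.
have nQy : y \in 'N(Q).
  have : Q :^ y \in [set Q in Om | Q \subset 'C[k]].
    rewrite inE; apply/andP; split.
      by apply/imsetP; exists (h * y); rewrite ?groupM // conjsgM defPh.
    have -> : k = k ^ y by apply/esym/conjg_fixP/commgP/cent1P.
    by rewrite cent1J conjSg.
  by rewrite defQ => /set1P nQ; rewrite inE nQ.
have : y \in 'N_G(P) :^ h by rewrite conjIg -normJ -defPh (conjGid Gh) inE Gy.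
by rewrite defN conjIg -centJ -defPh => /setIP[_]; rewrite sub_cent1.
Qed.

Lemma good_outside_normal G P F p :
    p.-Sylow(G) P -> F <| G -> F \proper G ->
    (forall x, x \in G :\: F -> p^'.-nat #|x ^: G|) ->
  [/\ 'N_G(P) = 'C_G(P), 'C_G(P) * F = G &
      forall y, y \in G -> ~~ p^'.-nat #|y ^: G| -> 'C_G[y] \subset F].
Proof.
move=> sylP nsF prF good.
have cover x : x \in G :\: F -> exists2 h, h \in G & P :^ h \subset 'C[x].
  move=> DFx; have [Q sylQ cQx] := class_good_Sylow (good x DFx).
  by have [h Gh defQ] := Sylow_trans sylP sylQ; exists h; rewrite -?defQ.
have [-> defG all_good] :=
  unique_centralised_conjugate (pHall_sub sylP) nsF prF cover.
split=> // y Gy; apply: contraR => /(all_good y Gy)[h Gh cPy].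
by apply: Sylow_class_good cPy; rewrite pHallJ.
Qed.

(** * Classes of size coprime to the maximal class size *)

(** Let C be the class of y. If the class sizes of u and y are coprime then
    C_G(y) C_G(u) = G, so all products of a conjugate of y and a conjugate of
    u form a single class D. Maximality gives |D| <= |C|, hence C u' = D for
    every conjugate u' of u, and right multiplication by a quotient of two
    conjugates of u stabilises C. So S can be the stabiliser of C under right
    multiplication, whose orbits on C have size |S|. *)
Lemma max_class_stabiliser G y :
    y \in G -> (forall z, z \in G -> #|z ^: G| <= #|y ^: G|) ->
  exists S : {group gT}, [/\ S <| G, #|S| %| #|y ^: G| &
    forall x g, x \in G -> g \in G -> coprime #|x ^: G| #|y ^: G| ->
      [~ x, g] \in S].
Proof.
move=> Gy maxy; set C := y ^: G.
have nCG : G \subset 'N(C) by rewrite class_norm.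
exists ('N_G(C | 'R))%G; split.
- rewrite /normal subsetIl; apply/subsetP=> n Gn; rewrite inE.
  apply/subsetP=> _ /imsetP[s /setIP[Gs /astabsP nCs] ->].
  rewrite inE groupJ //=; apply/astabsP=> x /=.
  have nCn := subsetP nCG n Gn.
  rewrite -{1}[x](conjgKV n) -conjMg memJ_norm //.
  by rewrite [LHS]nCs memJ_norm ?groupV.
- have actsC : [acts 'N_G(C | 'R), on C | 'R] by rewrite subsetIr.
  rewrite -(acts_sum_card_orbit actsC); apply: dvdn_sum => _ /imsetP[x Cx ->].
  by rewrite orbitR card_lcoset.
(* The commutator is the quotient of x^-1 by its conjugate under g, so the
   argument is applied to u = x^-1. *)
move=> x g Gx Gg co_xy.
have Gx1 : x^-1 \in G by rewrite groupV.
have defC1 : 'C_G[x^-1] = 'C_G[x] by rewrite -!cent_cycle cycleV.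
have defG : 'C_G[y] * 'C_G[x^-1] = G.
  apply: coprime_index_mulG; rewrite ?subsetIl //.
  by rewrite /= defC1 !index_cent1 coprime_sym.
pose D := (y * x^-1) ^: G.
have prodD h k : h \in G -> k \in G -> y ^ h * x^-1 ^ k \in D.
  move=> Gh Gk; have: h * k^-1 \in G by rewrite groupM ?groupV.
  rewrite -{1}defG => /mulsgP[a b /setIP[Ga cya] /setIP[Gb cxb] defab].
  have defbk : a^-1 * h = b * k by rewrite -[h](mulgKV k) defab -mulgA mulKg.
  have -> : y ^ h = y ^ (a^-1 * h).
    rewrite conjgM; congr (_ ^ h); apply/esym/conjg_fixP/commgP/commuteV.
    by apply/cent1P; rewrite cent1C.
  have -> : x^-1 ^ k = x^-1 ^ (b * k).
    rewrite conjgM; congr (_ ^ k); apply/esym/conjg_fixP/commgP.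
    by apply/cent1P; rewrite cent1C.
  by rewrite -defbk -conjMg memJ_class // groupM ?groupV.
have leD : #|D| <= #|C| by apply: maxy; rewrite groupM.
have defD k : k \in G -> C :* (x^-1 ^ k) = D.
  move=> Gk; apply/eqP; rewrite eqEcard card_rcoset leD andbT.
  apply/subsetP=> _ /rcosetP[_ /imsetP[h Gh ->] ->]; exact: prodD.
rewrite inE groupR //=; apply/astabsP=> z /=.
have -> : [~ x, g] = x^-1 * (x^-1 ^ g)^-1 by rewrite -conjVg invgK.
have -> : (z \in C) = (z * x^-1 \in C :* x^-1).
  by rewrite mem_rcoset mulgK.
by rewrite mulgA -mem_rcoset defD // -(defD 1) // conjg1.
Qed.

Lemma cent1_constt x pi : 'C[x] \subset 'C[x.`_pi].
Proof. by rewrite -!cent_cycle centS // cycle_subG cycle_constt. Qed.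

Lemma subcent1_constt G x pi : 'C_G[x] \subset 'C_G[x.`_pi].
Proof. by rewrite setIS ?cent1_constt. Qed.


Lemma mem_center G x : x \in G -> #|x ^: G| = 1%N -> x \in 'Z(G).
Proof.
move=> Gx /eqP; rewrite -index_cent1 indexg_eq1 subsetI => /andP[_ cGx].
by rewrite inE Gx -sub_cent1.
Qed.

Lemma normal_join_cycle G S u :
    S <| G -> u \in G -> (forall g, g \in G -> [~ u, g] \in S) ->
  S <*> <[u]> <| G.
Proof.
move=> /andP[sSG nSG] Gu cSu.
rewrite /normal join_subG sSG cycle_subG Gu.
apply/subsetP=> g Gg; rewrite inE conjYg (normsP nSG) // -cycleJ.
rewrite join_subG joing_subl cycle_subG conjg_mulR groupM //.
  by rewrite (subsetP (joing_subr _ _)) ?cycle_id.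
by rewrite (subsetP (joing_subl _ _)) ?cSu.
Qed.

(** The cyclic group <u> is a Sylow p-subgroup of the normal subgroup S<u>,
    and its normaliser centralises it, since [<u>, N_G(<u>)] lies in both <u>
    and S. By the Frattini argument G = S C_G(u). *)
Lemma class_size_dvd_normal_p' G S u p :
    S <| G -> p^'.-group S -> u \in G -> p.-elt u ->
    (forall g, g \in G -> [~ u, g] \in S) ->
  #|u ^: G| %| #|S|.
Proof.
move=> /andP[sSG nSG] p'S Gu pu cSu.
have nSu : <[u]> \subset 'N(S) by rewrite cycle_subG (subsetP nSG).
pose K := (S <*> <[u]>)%G.
have defK : K :=: S * <[u]> by rewrite /= norm_joinEr.
have nsKG : K <| G by apply: normal_join_cycle => //; apply/andP.
have sylu : p.-Sylow(K) <[u]>.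
  rewrite /pHall joing_subr [pgroup _ _]pu /= -divgS ?joing_subr //=.
  rewrite norm_joinEr //.
  rewrite -LagrangeMr mulnK ?cardG_gt0 //.
  by apply: pnat_dvd (dvdn_indexg _ _) p'S.
have cNu : 'N_G(<[u]>) \subset 'C_G[u].
  apply/subsetP=> n /setIP[Gn nun]; rewrite inE Gn; apply/cent1P.
  apply/esym/commgP; rewrite -in_set1.
  rewrite -[[set _]](coprime_TIg (pnat_coprime pu p'S)) inE cSu // andbT.
  by rewrite commgEl groupM ?groupV ?cycle_id // memJ_norm ?cycle_id.
have defG : G :=: 'C_G[u] * S.
  have nSC : 'C_G[u] \subset 'N(S) by rewrite subIset ?nSG.
  apply/eqP; rewrite eqEsubset mul_subG ?subsetIl // andbT.
  rewrite -norm_joinEl // -{1}(Frattini_arg nsKG sylu) mul_subG //.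
    rewrite join_subG joing_subr (subset_trans _ (joing_subl _ _)) //.
    by rewrite cycle_subG inE Gu cent1id.
  by rewrite (subset_trans cNu) ?joing_subl.
have iG : #|G : 'C_G[u]| = #|S : 'C_G[u]| by rewrite -[RHS]indexMg -defG.
by rewrite -index_cent1 iG dvdn_indexg.
Qed.

(** Modulo the stabiliser S of the maximal class, x is central, and so are its
    p-parts. For p outside pi the class size of the p-part divides |S|, a
    pi-number, but also the class size of x, a pi'-number: it is 1. The
    pi-part generates with S a normal pi-group, so lies in O_pi(G), and there
    its class size is again both a pi-number and a pi'-number. *)
Lemma small_class_central G y x pi :
    y \in G -> (forall z, z \in G -> #|z ^: G| <= #|y ^: G|) ->
    pi.-nat #|y ^: G| -> x \in G -> pi^'.-nat #|x ^: G| ->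
  x.`_pi^' \in 'Z(G) /\ x.`_pi \in 'Z('O_pi(G)).
Proof.
move=> Gy maxy piy Gx pi'x.
have [S [nsSG dvS cS]] := max_class_stabiliser Gy maxy.
have [sSG nSG] := andP nsSG.
have piS : pi.-group S by apply: pnat_dvd dvS piy.
have pi'class z : 'C_G[x] \subset 'C_G[z] -> pi^'.-nat #|z ^: G|.
  by move/dvdn_class_size=> dvz; apply: pnat_dvd dvz pi'x.
have cSz z g : z \in G -> 'C_G[x] \subset 'C_G[z] -> g \in G -> [~ z, g] \in S.
  move=> Gz /pi'class pi'z Gg; apply: cS => //.
  by rewrite coprime_sym; apply: pnat_coprime piy pi'z.
have Gc z rho : z \in G -> z.`_rho \in G by apply: groupX.
split.
  rewrite -(prod_constt x.`_pi^'); apply: group_prod => p _.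
  set u := _.`_p; have Gu : u \in G by rewrite !Gc.
  have sCu : 'C_G[x] \subset 'C_G[u].
    by apply: subset_trans (subcent1_constt _ _ _) (subcent1_constt _ _ _).
  have [pi_p | pi'p] := boolP (p \in pi).
    rewrite [u](constt1P _) ?group1 //.
    apply: sub_p_elt (p_elt_constt _ _) => q; rewrite !inE.
    by apply: contraNneq => ->.
  apply: mem_center => //; apply: (@pnat_1 pi); last exact: pi'class.
  apply: (pnat_dvd _ piS); apply: (@class_size_dvd_normal_p' _ _ _ p) => //.
  - apply: sub_pgroup piS => q pi_q; rewrite !inE.
    by apply: contraTneq pi_q => ->.
  - exact: p_elt_constt.
  by move=> g; apply: cSz.
set v := x.`_pi; have Gv : v \in G by rewrite Gc.
have sCv : 'C_G[x] \subset 'C_G[v] by exact: subcent1_constt.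
have nSv : <[v]> \subset 'N(S) by rewrite cycle_subG (subsetP nSG).
have sKO : S <*> <[v]> \subset 'O_pi(G).
  apply: pcore_max.
    by rewrite /= norm_joinEr // pgroupM piS [pgroup _ _]p_elt_constt.
  by apply: normal_join_cycle => // g; apply: cSz.
have Ov : v \in 'O_pi(G).
  by rewrite (subsetP sKO) // mem_gen // inE cycle_id orbT.
rewrite inE Ov -sub_cent1 -indexg_eq1; apply/eqP/(@pnat_1 pi).
  by apply: pnat_dvd (dvdn_indexg _ _) (pcore_pgroup _ _).
by apply: pnat_dvd (dvdn_class_normal (pcore_normal _ _) Gv) (pi'class v sCv).
Qed.

(** In the subgroup M generated by the pi-elements, a Sylow q-subgroup with q
    outside pi is central. By Schur-Zassenhaus M has a normal q-complement,
    which contains all pi-elements, hence M; so q does not divide |M|. *)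
Lemma commuting_pi_core H pi :
    (forall u v, u \in H -> v \in H -> pi.-elt u -> pi^'.-elt v ->
       commute u v) ->
  forall u, u \in H -> pi.-elt u -> u \in 'O_pi(H).
Proof.
move=> comm.
pose M := <<[set u in H | pi.-elt u]>>%G.
have sMH : M \subset H.
  by rewrite gen_subG; apply/subsetP=> u /setIdP[].
suffices piM : pi.-group M.
  have sMO : M \subset 'O_pi(H).
    apply: pcore_max => //; rewrite /normal sMH norms_gen //.
    apply/subsetP=> g Hg; rewrite inE.
    apply/subsetP=> _ /imsetP[u /setIdP[Hu piu] ->].
    by rewrite inE groupJ // p_eltJ.
  by move=> u Hu piu; rewrite (subsetP sMO) // mem_gen // inE Hu.
apply/pgroupP=> q q_pr q_dv; apply: contraLR q_dv => pi'q.
have [Q sylQ] := Sylow_exists q M.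
have [sQM qQ _] := and3P sylQ.
have cMQ : M \subset 'C(Q).
  rewrite gen_subG; apply/subsetP=> u /setIdP[Hu piu]; apply/centP=> v Qv.
  apply: comm => //; first by rewrite (subsetP sMH) ?(subsetP sQM).
  have := mem_p_elt qQ Qv; apply: sub_p_elt => r; rewrite !inE => /eqP->.
  by [].
have nsQM : Q <| M by rewrite /normal sQM cents_norm.
have /splitsP[K complK] : [splits M, over Q].
  exact: SchurZassenhaus_split (pHall_Hall sylQ) nsQM.
have hallK : q^'.-Hall(M) K by rewrite -(compl_pHall _ sylQ).
have nsKM : K <| M.
  have [_ defM] := complP complK; rewrite /normal (pHall_sub hallK) -defM.
  rewrite mul_subG ?normG // cents_norm // centsC.
  by rewrite (subset_trans (pHall_sub hallK)).
have sMK : M \subset K.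
  rewrite gen_subG; apply/subsetP=> u /setIdP[Hu piu].
  rewrite (mem_normal_Hall hallK nsKM); last by rewrite mem_gen // inE Hu.
  by apply: sub_p_elt piu => r pi_r; rewrite !inE; apply: contraTneq pi_r => ->.
have := pgroupS sMK (pHall_pgroup hallK).
by rewrite p'groupEpi mem_primes q_pr cardG_gt0.
Qed.

(** * Class sizes and sets of primes *)

Lemma class_not_p'natP G pi x :
  ~~ pi^'.-nat #|x ^: G| -> exists p, [/\ prime p, p %| #|x ^: G| & p \in pi].
Proof.
rewrite /pnat class_size_gt0 => /allPn[p].
by rewrite mem_primes => /and3P[p_pr _ p_dv] /negPn pi_p; exists p.
Qed.

Lemma class_not_p'nat_mono G pi x y :
  'C_G[y] \subset 'C_G[x] -> ~~ pi^'.-nat #|x ^: G| -> ~~ pi^'.-nat #|y ^: G|.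
Proof. by move/dvdn_class_size=> dv; apply: contra; apply: pnat_dvd. Qed.

Lemma normal_subcent G M : M <| G -> 'C_G(M) <| G.
Proof.
move=> /andP[_ nMG]; rewrite /normal subsetIl normsI ?normG //.
exact: subset_trans nMG (cent_norm _).
Qed.

(** An element that does not centralise the normal sigma-subgroup M has a
    class size divisible by |M : C_M(x)|, hence by a prime of sigma; so it is
    not bad for rho, and the count applies with F = C_G(M). *)
Lemma nonadjacent_normal_cent G M rho sigma P p :
    (forall x, x \in G -> rho^'.-nat #|x ^: G| || sigma^'.-nat #|x ^: G|) ->
    M <| G -> sigma.-group M -> ~~ (M \subset 'Z(G)) ->
    p \in rho -> p.-Sylow(G) P ->
  [/\ 'N_G(P) = 'C_G(P), 'C_G(P) * 'C_G(M) = G &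
      forall y, y \in G -> ~~ p^'.-nat #|y ^: G| -> 'C_G[y] \subset 'C_G(M)].
Proof.
move=> nonadj nsM sM ncM rho_p sylP.
apply: good_outside_normal sylP (normal_subcent nsM) _ _ => [|x /setDP[Gx]].
  rewrite properEneq subsetIl andbT; apply: contraNneq ncM => /setIidPl cGM.
  by rewrite subsetI (normal_sub nsM) centsC.
rewrite inE Gx /= -sub_cent1 -indexg_eq1 => ncMx.
have [rho'x|] := orP (nonadj x Gx); first exact: pi'_p'nat rho'x rho_p.
move=> sigma'x; case/eqP: ncMx; apply: (@pnat_1 sigma).
  exact: pnat_dvd (dvdn_indexg _ _) sM.
exact: pnat_dvd (dvdn_class_normal nsM Gx) sigma'x.
Qed.

Lemma class_size_centralM G z x :
  z \in 'Z(G) -> #|(z * x) ^: G| = #|x ^: G|.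
Proof.
case/setIP=> Gz cGz; rewrite -!index_cent1; congr #|_ : _|.
apply/setP=> g; rewrite !in_setI; case Gg: (g \in G) => //=.
have cgz : commute g z by apply/esym/(centP cGz).
apply/cent1P/cent1P => [cgzx | cgx]; last exact: commuteM.
by rewrite -[x](mulKg z); apply: commuteM => //; exact: commuteV.
Qed.

Lemma mem_pcore_normal G H pi v :
  H <| G -> v \in 'O_pi(H) -> v \in 'O_pi(G).
Proof.
move=> nsHG; apply: (subsetP (pcore_max _ _)); first exact: pcore_pgroup.
exact: gFnormal_trans.
Qed.

Lemma mem_pcore_abelian H pi v :
  abelian H -> v \in H -> pi.-elt v -> v \in 'O_pi(H).
Proof.
move=> cHH Hv.
have hallO := nilpotent_pcore_Hall pi (abelian_nil cHH).
by rewrite (mem_normal_Hall hallO) ?pcore_normal.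
Qed.

Lemma pi_elt_normal G F pi t :
  F <| G -> pi^'.-nat #|G : F| -> t \in G -> pi.-elt t -> t \in F.
Proof.
move=> nsFG pi'iF Gt pit; have nFt := subsetP (normal_norm nsFG) t Gt.
apply: coset_idr => //; apply/eqP; rewrite -order_eq1; apply/eqP.
apply: (@pnat_1 pi); first exact: morph_p_elt.
apply: pnat_dvd pi'iF; rewrite -card_quotient ?normal_norm //.
by rewrite order_dvdG ?mem_quotient.
Qed.

(** * Squares of class sizes *)

(** For disjoint sets of primes this is an edge between them. *)
Definition joint_class G pi1 pi2 :=
  exists2 x, x \in G & ~~ pi1^'.-nat #|x ^: G| /\ ~~ pi2^'.-nat #|x ^: G|.

(** The block square condition on class sizes, with rho, sigma, alpha, beta
    for pi1, pi4, pi2, pi3. Since the sum of membership bits is at most 1, the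
    four sets are pairwise disjoint, in a form that survives the exchanges
    below. *)
Record square_graph G rho sigma alpha beta : Prop := SquareGraph {
  sq_rs : forall x, x \in G -> rho^'.-nat #|x ^: G| || sigma^'.-nat #|x ^: G|;
  sq_ab : forall x, x \in G -> alpha^'.-nat #|x ^: G| || beta^'.-nat #|x ^: G|;
  sq_cover : forall x p, x \in G -> prime p -> p %| #|x ^: G| ->
    [|| p \in rho, p \in sigma, p \in alpha | p \in beta];
  sq_disj : forall p,
    (p \in rho) + (p \in sigma) + (p \in alpha) + (p \in beta) <= 1;
  sq_ra : joint_class G rho alpha;
  sq_rb : joint_class G rho beta;
  sq_sa : joint_class G sigma alpha;
  sq_sb : joint_class G sigma beta
}.

Lemma joint_classC G pi1 pi2 : joint_class G pi1 pi2 -> joint_class G pi2 pi1.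
Proof. by case=> x Gx [b1 b2]; exists x. Qed.

Lemma square_swap_rs G rho sigma alpha beta :
  square_graph G rho sigma alpha beta -> square_graph G sigma rho alpha beta.
Proof.
case=> rs ab cov dis ra rb sa sb; split=> // [x Gx | x p Gx p_pr p_dv | p].
- by rewrite orbC rs.
- by have := cov x p Gx p_pr p_dv; rewrite orbCA.
by have := dis p; rewrite [(p \in rho) + _]addnC.
Qed.

Lemma square_swap_pairs G rho sigma alpha beta :
  square_graph G rho sigma alpha beta -> square_graph G alpha beta rho sigma.
Proof.
case=> rs ab cov dis ra rb sa sb.
split=> // [x p Gx p_pr p_dv | p | | | |]; try exact: joint_classC.
  by have := cov x p Gx p_pr p_dv; rewrite orbA orbC -orbA.
by have := dis p; rewrite -addnA addnC addnA.
Qed.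

End Groups.

(** * The centraliser of a pivot *)

Section Pivot.

Variables (gT : finGroupType) (G : {group gT}).
Implicit Types (H K M N P Q F S : {group gT}) (x y z u v w : gT) (p : nat).
Implicit Types (pi rho sigma alpha beta tau : nat_pred).

(** The field [pv_center] is the consequence of [small_class_central] that is
    used once the maximal class has played its part: it is symmetric under the
    exchange of the two pairs, so each lemma below also holds with (rho,
    sigma) and (alpha, beta) exchanged. *)
Record pivot rho sigma alpha beta tau x : Prop := Pivot {
  pv_sq : square_graph G rho sigma alpha beta;
  pv_tau : forall p, (p \in tau) = (p \in sigma) || (p \in beta);
  pv_center : forall z, z \in G ->
    ~~ rho^'.-nat #|z ^: G| -> ~~ alpha^'.-nat #|z ^: G| ->
    z.`_tau^' \in 'Z(G) /\ z.`_tau \in 'Z('O_tau(G));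
  pv_x : x \in 'Z('O_tau(G));
  pv_rho : ~~ rho^'.-nat #|x ^: G|;
  pv_alpha : ~~ alpha^'.-nat #|x ^: G|
}.

Lemma pivot_sym rho sigma alpha beta tau x :
  pivot rho sigma alpha beta tau x ->
  pivot alpha beta rho sigma tau x.
Proof.
case=> sq tauE Zx x_in rx ax; split=> //; first exact: square_swap_pairs.
  by move=> p; rewrite tauE orbC.
by move=> z Gz az rz; apply: Zx.
Qed.

Lemma bad_class_tau' rho sigma alpha beta tau z :
    square_graph G rho sigma alpha beta ->
    (forall p, (p \in tau) = (p \in sigma) || (p \in beta)) ->
    z \in G -> ~~ rho^'.-nat #|z ^: G| -> ~~ alpha^'.-nat #|z ^: G| ->
  tau^'.-nat #|z ^: G|.
Proof.
move=> sq tauE Gz rz az; have := sq_rs sq Gz; have := sq_ab sq Gz.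
rewrite (negPf rz) (negPf az) /= => b'z s'z.
apply/pnatP=> [|p p_pr p_dv]; first exact: class_size_gt0.
rewrite !inE tauE; apply/norP; split.
  exact: (pnatP _ (class_size_gt0 _ _) s'z).
exact: (pnatP _ (class_size_gt0 _ _) b'z).
Qed.

Section PivotCentraliser.

Variables (rho sigma alpha beta tau : nat_pred) (x : gT).
Hypothesis S : pivot rho sigma alpha beta tau x.

Let sq := pv_sq S.
Let tauE := pv_tau S.
Let F1 := 'C_G('O_sigma(G))%G.

Let ZO_G z : z \in 'Z('O_tau(G)) -> z \in G.
Proof. by case/setIP=> Oz _; rewrite (subsetP (pcore_sub tau G)). Qed.

Let Gx : x \in G. Proof. exact: ZO_G (pv_x S). Qed.

Let ZO_elt z : z \in 'Z('O_tau(G)) -> tau.-elt z.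
Proof. by case/setIP=> Oz _; apply: mem_p_elt (pcore_pgroup _ _) Oz. Qed.

Let sub_sigma : {subset sigma <= tau}.
Proof. by move=> p s_p; rewrite tauE s_p. Qed.

Lemma pivot_class_tau' : tau^'.-nat #|x ^: G|.
Proof. exact: bad_class_tau' sq tauE Gx (pv_rho S) (pv_alpha S). Qed.

(** The product v x has x as its tau-part, so it is bad wherever x is; then
    its tau'-part v is central. *)
Lemma pivot_cent_tau'_central v : v \in 'C_G[x] -> tau^'.-elt v -> v \in 'Z(G).
Proof.
case/setIP=> Gv /cent1P cvx t'v.
have tx := ZO_elt (pv_x S).
have Gvx : v * x \in G by rewrite groupM.
have vx_t : (v * x).`_tau = x.
  by rewrite consttM // (constt1P t'v) mul1g constt_p_elt.
have vx_t' : (v * x).`_tau^' = v.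
  rewrite consttM // (constt_p_elt t'v) (constt1P _) ?mulg1 //.
  by rewrite p_eltNK.
have sC : 'C_G[v * x] \subset 'C_G[x].
  by rewrite -{2}vx_t subcent1_constt.
have [] := pv_center S Gvx; last by rewrite vx_t'.
  exact: class_not_p'nat_mono sC (pv_rho S).
exact: class_not_p'nat_mono sC (pv_alpha S).
Qed.

(** As v w is again bad for rho and for alpha, it lies in Z(O_tau(G)), and so
    does its pi-part v. *)
Lemma pivot_cent_pi_elt pi w v :
    {subset pi <= tau} -> w \in 'Z('O_tau(G)) -> pi^'.-elt w ->
    ~~ rho^'.-nat #|w ^: G| -> ~~ alpha^'.-nat #|w ^: G| ->
    v \in 'C_G[w] -> pi.-elt v ->
  v \in 'O_pi(G).
Proof.
move=> s_pi ZOw pi'w rw aw /setIP[Gv /cent1P cvw] piv.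
have Gw := ZO_G ZOw; have Gvw : v * w \in G by rewrite groupM.
have vw_pi : (v * w).`_pi = v.
  by rewrite consttM // (constt_p_elt piv) (constt1P pi'w) mulg1.
have vw_pi' : (v * w).`_pi^' = w.
  by rewrite consttM // (constt_p_elt pi'w) (constt1P _) ?mul1g // p_eltNK.
have sC : 'C_G[v * w] \subset 'C_G[w].
  by rewrite -{2}vw_pi' subcent1_constt.
have [||_] := pv_center S Gvw.
- exact: class_not_p'nat_mono sC rw.
- exact: class_not_p'nat_mono sC aw.
rewrite constt_p_elt; last first.
  by apply: p_eltM => //; [exact: sub_p_elt piv | exact: ZO_elt].
move=> ZOvw; have ZOv : v \in 'Z('O_tau(G)) by rewrite -vw_pi groupX.
apply: (@mem_pcore_normal _ _ 'Z('O_tau(G))).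
  exact: char_normal_trans (center_char _) (pcore_normal _ _).
by apply: mem_pcore_abelian => //; apply: center_abelian.
Qed.

(** If O_pi(G) were central, removing the pi-part of x would not change its
    class, and by [pivot_cent_pi_elt] a Sylow s-subgroup centralising the
    pi'-part of x, for s in pi, would lie in O_pi(G) and be central: s would
    divide no class size. *)
Lemma pivot_pcore_noncentral pi :
    {subset pi <= tau} ->
    (exists2 z, z \in G & ~~ pi^'.-nat #|z ^: G|) ->
  ~~ ('O_pi(G) \subset 'Z(G)).
Proof.
move=> s_pi [z Gz /class_not_p'natP[s [s_pr s_dv pi_s]]]; apply/negP=> cO.
set w := x.`_pi^'.
have nsA : 'Z('O_tau(G)) <| G.
  exact: char_normal_trans (center_char _) (pcore_normal _ _).
have Zx : x.`_pi \in 'Z(G).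
  apply: (subsetP cO); apply: (mem_pcore_normal nsA).
  apply: mem_pcore_abelian; [exact: center_abelian | | exact: p_elt_constt].
  by rewrite groupX // (pv_x S).
have Aw : w \in 'Z('O_tau(G)) by rewrite groupX // (pv_x S).
have eqw : #|w ^: G| = #|x ^: G|.
  by rewrite -(class_size_centralM w Zx) consttC.
have s'w : s^'.-nat #|w ^: G|.
  by rewrite eqw; apply: pi'_p'nat pivot_class_tau' (s_pi _ pi_s).
have [Q sylQ cQw] := class_good_Sylow s'w.
have sQZ : Q \subset 'Z(G).
  apply: subset_trans cO; apply/subsetP=> v Qv.
  apply: (@pivot_cent_pi_elt pi w); rewrite ?eqw ?(pv_rho S) ?(pv_alpha S) //.
  - exact: p_elt_constt.
  - by rewrite inE (subsetP (pHall_sub sylQ)) // (subsetP cQw).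
  apply: sub_p_elt (mem_p_elt (pHall_pgroup sylQ) Qv) => r.
  by rewrite !inE => /eqP->.
have cQz : Q \subset 'C[z].
  rewrite sub_cent1; apply: subsetP Gz; rewrite centsC.
  by apply: subset_trans sQZ (subsetIr _ _).
by have := Sylow_class_good sylQ cQz; rewrite p'natE // s_dv.
Qed.

Lemma core_noncentral : ~~ ('O_sigma(G) \subset 'Z(G)).
Proof.
apply: pivot_pcore_noncentral sub_sigma _.
by have [z Gz [sz _]] := sq_sa sq; exists z.
Qed.

(** The form in which the count bounds centralisers below: the Sylow subgroup
    has disappeared, and any prime of rho serves. *)
Lemma rho_class_cent_core y :
  y \in G -> ~~ rho^'.-nat #|y ^: G| -> 'C_G[y] \subset F1.
Proof.
move=> Gy /class_not_p'natP[p [p_pr p_dv r_p]].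
have [P sylP] := Sylow_exists p G.
have [_ _ ->] // := nonadjacent_normal_cent (sq_rs sq) (pcore_normal _ _)
  (pcore_pgroup _ _) core_noncentral r_p sylP.
by rewrite p'natE // p_dv.
Qed.

Lemma rho_Sylow_norm_cent P p : p \in rho -> p.-Sylow(G) P ->
  'N_G(P) = 'C_G(P) /\ 'C_G(P) * F1 = G.
Proof.
move=> r_p sylP.
by have [] := nonadjacent_normal_cent (sq_rs sq) (pcore_normal _ _)
  (pcore_pgroup _ _) core_noncentral r_p sylP.
Qed.

Lemma pivot_cent_core : 'C_G[x] \subset F1.
Proof. exact: rho_class_cent_core Gx (pv_rho S). Qed.

Lemma pcore_sub_pivot_cent pi : {subset pi <= tau} -> 'O_pi(G) \subset 'C_G[x].
Proof.
move=> s_pi; apply: subset_trans (sub_pcore _ s_pi) _.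
by rewrite subsetI pcore_sub sub_cent1; case/setIP: (pv_x S).
Qed.

Lemma pcore_cent_core pi :
  {subset pi <= tau} -> 'O_pi(G) \subset 'C('O_sigma(G)).
Proof.
move=> s_pi; apply: subset_trans (pcore_sub_pivot_cent s_pi) _.
by apply: subset_trans pivot_cent_core (subsetIr _ _).
Qed.

Lemma pivot_sigma_part : x.`_sigma \in 'O_sigma(G).
Proof.
apply: (@mem_pcore_normal _ _ 'Z('O_tau(G))).
  exact: char_normal_trans (center_char _) (pcore_normal _ _).
apply: mem_pcore_abelian; [exact: center_abelian | | exact: p_elt_constt].
by rewrite groupX // (pv_x S).
Qed.

Let sigma'_beta v : tau.-elt v -> sigma^'.-elt v -> beta.-elt v.
Proof.
move=> tv s'v; apply/pnatP=> // p p_pr p_dv.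
have := pnatP _ (order_gt0 v) tv p p_pr p_dv.
have := pnatP _ (order_gt0 v) s'v p p_pr p_dv.
by rewrite tauE !inE => /negPf->.
Qed.

Lemma pivot_sigma'_part : x.`_sigma^' \in 'O_beta(G).
Proof.
apply: (@mem_pcore_normal _ _ 'Z('O_tau(G))).
  exact: char_normal_trans (center_char _) (pcore_normal _ _).
apply: mem_pcore_abelian; first exact: center_abelian.
  by rewrite groupX // (pv_x S).
apply: sigma'_beta (p_elt_constt _ _); apply: p_eltX; exact: ZO_elt (pv_x S).
Qed.

(** The index divides the class size of the pivot, a tau'-number, and that of
    an element bad for rho and beta, which is not bad for alpha; only primes
    of rho remain. *)
Lemma core_cent_index : rho.-nat #|G : F1|.
Proof.
have [y Gy [ry by_]] := sq_rb sq.
have dvx : #|G : F1| %| #|x ^: G|.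
  by rewrite -index_cent1 indexgS // pivot_cent_core.
have dvy : #|G : F1| %| #|y ^: G|.
  by rewrite -index_cent1 indexgS // rho_class_cent_core.
have a'y : alpha^'.-nat #|y ^: G|.
  by have := sq_ab sq Gy; rewrite (negPf by_) orbF.
apply/pnatP=> // p p_pr p_dv.
have p_dvx := dvdn_trans p_dv dvx.
have := sq_cover sq Gx p_pr p_dvx.
have := pnatP _ (class_size_gt0 _ _) a'y p p_pr (dvdn_trans p_dv dvy).
have := pnatP _ (class_size_gt0 _ _) pivot_class_tau' p p_pr p_dvx.
by rewrite !inE tauE => /norP[/negPf-> /negPf->] /negPf->; rewrite !orbF.
Qed.

End PivotCentraliser.

Section PivotParts.

Variables (rho sigma alpha beta tau : nat_pred) (x : gT).
Hypothesis S : pivot rho sigma alpha beta tau x.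

Let S' := pivot_sym S.
Let sq := pv_sq S.
Let tauE := pv_tau S.
Let F1 := 'C_G('O_sigma(G))%G.
Let F2 := 'C_G('O_beta(G))%G.

Let Gx : x \in G.
Proof. by case/setIP: (pv_x S) => /(subsetP (pcore_sub tau G)). Qed.

(** The pivot is the product of its sigma-part in O_sigma(G) and its beta-part
    in O_beta(G), so it commutes with the intersection. *)
Lemma pivot_centE : 'C_G[x] = F1 :&: F2.
Proof.
apply/eqP; rewrite eqEsubset subsetI.
rewrite (pivot_cent_core S) (pivot_cent_core S') /=.
apply/subsetP=> g /setIP[/setIP[Gg cg1] /setIP[_ cg2]].
rewrite inE Gg /=; apply/cent1P; rewrite -(consttC sigma x).
apply: commuteM; [apply: (centP cg1) | apply: (centP cg2)].
  exact: pivot_sigma_part S.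
exact: pivot_sigma'_part S.
Qed.

Lemma pivot_cent_normal : 'C_G[x] <| G.
Proof. by rewrite pivot_centE normalI // normal_subcent ?pcore_normal. Qed.

(** The sigma'-part of the pivot is its beta-part, and its class size is an
    alpha-number. If it were not bad for alpha it would be central, and the
    class size of the pivot would be that of its sigma-part, a rho-number. *)
Lemma pivot_sigma'_part_class : ~~ alpha^'.-nat #|x.`_sigma^' ^: G|.
Proof.
have Gxs : x.`_sigma^' \in G by rewrite groupX.
apply/negP=> a'x.
have sF2C : F2 \subset 'C_G[x.`_sigma^'].
  by rewrite setIS // -cent_set1 centS // sub1set (pivot_sigma'_part S).
have sF1C : F1 \subset 'C_G[x.`_sigma].
  by rewrite setIS // -cent_set1 centS // sub1set (pivot_sigma_part S).
have Zxs : x.`_sigma^' \in 'Z(G).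
  apply: mem_center => //; apply: (@pnat_1 alpha) => //.
  by apply: (pnat_dvd _ (core_cent_index S')); rewrite -index_cent1 indexgS.
case/negP: (pv_alpha S).
have -> : #|x ^: G| = #|x.`_sigma ^: G|.
  have ex := consttC sigma^' x; rewrite consttNK in ex.
  by rewrite -{1}ex class_size_centralM.
have r_i : rho.-nat #|x.`_sigma ^: G|.
  by apply: (pnat_dvd _ (core_cent_index S)); rewrite -index_cent1 indexgS.
apply: sub_in_pnat r_i => p _ r_p; rewrite !inE.
by have := sq_disj sq p; rewrite r_p; do !case: (p \in _).
Qed.

(** Multiplying u by the beta-part of the pivot makes it bad for alpha, hence
    not for beta. *)
Lemma sigma_elt_class u :
  u \in 'C_G[x] -> sigma.-elt u -> beta^'.-nat #|u ^: G|.
Proof.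
move=> Fu su; have [Gu cux] := setIP Fu; set v := x.`_sigma^'.
have s'v : sigma^'.-elt v by apply: p_elt_constt.
have cuv : commute u v by apply: commuteX; apply/cent1P.
have Guv : u * v \in G by rewrite groupM // groupX.
have uv_s : (u * v).`_sigma = u.
  by rewrite consttM // (constt_p_elt su) (constt1P s'v) mulg1.
have uv_s' : (u * v).`_sigma^' = v.
  by rewrite consttM // (constt_p_elt s'v) (constt1P _) ?mul1g // p_eltNK.
have a_uv : ~~ alpha^'.-nat #|(u * v) ^: G|.
  apply: class_not_p'nat_mono pivot_sigma'_part_class.
  by rewrite -[x.`__]uv_s' subcent1_constt.
have := sq_ab sq Guv; rewrite (negPf a_uv) /=.
by apply: pnat_dvd; apply: dvdn_class_size; rewrite -{2}uv_s subcent1_constt.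
Qed.

(** Outside tau the Sylow subgroups of C_G(x) are central in G. *)
Lemma pivot_cent_class_tau u : u \in 'C_G[x] -> tau.-nat #|'C_G[x] : 'C[u]|.
Proof.
move=> Fu; apply/pnatP=> // p p_pr; apply: contraLR => t'p.
have [Q sylQ] := Sylow_exists p 'C_G[x].
have cQu : Q \subset 'C[u].
  apply/subsetP=> v Qv.
  have Zv : v \in 'Z(G).
    apply: (pivot_cent_tau'_central S).
      exact: subsetP (pHall_sub sylQ) v Qv.
    apply: sub_p_elt (mem_p_elt (pHall_pgroup sylQ) Qv) => r.
    by rewrite !inE => /eqP->.
  have Gu : u \in G by case/setIP: Fu.
  by apply/cent1P; case/setIP: Zv => _ /centP; apply.
have := Sylow_class_good sylQ cQu.
by rewrite -index_cent1 indexgI p'natE.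
Qed.

Lemma pivot_cent_class_sigma u :
  u \in 'C_G[x] -> sigma.-elt u -> sigma.-nat #|'C_G[x] : 'C[u]|.
Proof.
move=> Fu su; have Gu : u \in G by case/setIP: Fu.
have b'u : beta^'.-nat #|'C_G[x] : 'C[u]|.
  apply: pnat_dvd (dvdn_class_normal pivot_cent_normal Gu) _.
  exact: sigma_elt_class.
have := pivot_cent_class_tau Fu; apply: sub_in_pnat => p p_in.
have := pnatPpi b'u p_in; rewrite !inE tauE => /negPf->.
by rewrite orbF.
Qed.

End PivotParts.

Section CommutingElements.

Variables (rho sigma alpha beta tau : nat_pred) (x : gT).
Hypothesis S : pivot rho sigma alpha beta tau x.

Let S' := pivot_sym S.
Let sq := pv_sq S.
Let tauE := pv_tau S.

(** In F = C_G(x) the class sizes of u and v are a sigma-number and a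
    beta-number, so F = C_F(v) C_F(u). Some conjugate of v lies in a Sylow
    p-subgroup centralised by u; by this factorisation it is a conjugate of v
    under C_F(u), so u commutes with v itself. *)
Lemma sigma_elt_commute_prime u v p :
    u \in 'C_G[x] -> v \in 'C_G[x] -> sigma.-elt u -> p.-elt v -> p \in beta ->
  commute u v.
Proof.
move=> Fu Fv su pv b_p.
have bv : beta.-elt v by apply: sub_p_elt pv => r; rewrite !inE => /eqP->.
have iu := pivot_cent_class_sigma S Fu su.
have iv := pivot_cent_class_sigma S' Fv bv.
have disj q : q \in beta -> q \notin sigma.
  by have := sq_disj sq q; do !case: (q \in _).
have defF : 'C_('C_G[x])[v] * 'C_('C_G[x])[u] = 'C_G[x].
  apply: coprime_index_mulG; rewrite ?subsetIl // !indexgI.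
  apply: pnat_coprime iv _; apply: sub_in_pnat iu => q _.
  by apply: contraL; apply: disj.
have p'u : p^'.-nat #|u ^: 'C_G[x]|.
  rewrite -index_cent1 indexgI; apply: sub_in_pnat iu => q _.
  by apply: contraTneq => ->; apply: disj.
have [Q sylQ cQu] := class_good_Sylow p'u.
have sVF : <[v]> \subset 'C_G[x] by rewrite cycle_subG.
have [h Fh] := Sylow_Jsub sylQ sVF pv.
rewrite -cycleJ cycle_subG => Qvh.
have : h \in 'C_('C_G[x])[v] * 'C_('C_G[x])[u] by rewrite defF.
case/mulsgP=> a b /setIP[_ cva] /setIP[_ cub] defh.
have vJ : v ^ h = v ^ b.
  rewrite defh conjgM; congr (_ ^ b); apply/conjg_fixP/commgP.
  by apply/cent1P; rewrite cent1C.
have : v ^ b \in 'C[u] by rewrite -vJ (subsetP cQu).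
rewrite -{1}(_ : u ^ b = u); last first.
  by apply/conjg_fixP/commgP/cent1P; rewrite cent1C.
by rewrite cent1J memJ_conjg => /cent1P/esym.
Qed.

Lemma sigma_elt_commute u w :
    u \in 'C_G[x] -> w \in 'C_G[x] -> sigma.-elt u -> sigma^'.-elt w ->
  commute u w.
Proof.
move=> Fu Fw su s'w; apply/esym/cent1P.
rewrite -(prod_constt w); apply: group_prod => p _.
have Fwp : w.`_p \in 'C_G[x] by rewrite groupX.
have [s_p | s'p] := boolP (p \in sigma).
  rewrite (constt1P _) ?group1 //; apply: sub_p_elt s'w => q.
  by rewrite !inE; apply: contraNneq => ->.
apply/cent1P/esym; have [b_p | b'p] := boolP (p \in beta).
  exact: sigma_elt_commute_prime Fu Fwp su (p_elt_constt _ _) b_p.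
have Zw : w.`_p \in 'Z(G).
  apply: (pivot_cent_tau'_central S Fwp).
  apply: sub_p_elt (p_elt_constt _ _) => q.
  by rewrite !inE tauE negb_or => /eqP->; rewrite s'p.
by apply: commute_sym; case/setIP: Zw => _ /centP; apply; case/setIP: Fu.
Qed.

Lemma sigma_elt_in_core u :
  u \in 'C_G[x] -> sigma.-elt u -> u \in 'O_sigma(G).
Proof.
move=> Fu su; apply: (mem_pcore_normal (pivot_cent_normal S)).
by apply: commuting_pi_core su => // v w Fv Fw; apply: sigma_elt_commute.
Qed.

End CommutingElements.

(** * The core O_tau(G) and its complement *)

Section Core.

Variables (rho sigma alpha beta tau : nat_pred) (x : gT).
Hypothesis S : pivot rho sigma alpha beta tau x.

Let S' := pivot_sym S.
Let sq := pv_sq S.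
Let tauE := pv_tau S.
Let F1 := 'C_G('O_sigma(G))%G.
Let F2 := 'C_G('O_beta(G))%G.

Let Gx : x \in G.
Proof. by case/setIP: (pv_x S) => /(subsetP (pcore_sub tau G)). Qed.

Lemma tau_core_prod : 'O_tau(G) = 'O_sigma(G) * 'O_beta(G).
Proof.
have s_tau : {subset sigma <= tau} by move=> p; rewrite tauE => ->.
have b_tau : {subset beta <= tau} by move=> p; rewrite tauE orbC => ->.
apply/eqP; rewrite eqEsubset mul_subG ?sub_pcore // andbT.
apply/subsetP=> u Ou; have Fu : u \in 'C_G[x].
  by apply: (subsetP (pcore_sub_pivot_cent S _)) Ou.
have tu := mem_p_elt (pcore_pgroup _ _) Ou.
rewrite -(consttC sigma u) mem_mulg //.
  by apply: (sigma_elt_in_core S); rewrite ?p_elt_constt // groupX.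
apply: (sigma_elt_in_core S'); first by rewrite groupX.
have t_u : tau.-elt u.`_sigma^' by apply: p_eltX.
apply/pnatP=> // p p_pr p_dv.
have := pnatP _ (order_gt0 _) t_u p p_pr p_dv.
have := pnatP _ (order_gt0 _) (p_elt_constt sigma^' u) p p_pr p_dv.
by rewrite tauE !inE => /negPf->.
Qed.

(** C_G(x) is normal of tau'-index, so it contains the Sylow p-subgroups for p
    in tau, whose elements lie in O_sigma(G) or in O_beta(G). *)
Lemma tau_core_Hall : tau.-Hall(G) 'O_tau(G).
Proof.
rewrite /pHall pcore_sub pcore_pgroup /=.
apply/pnatP=> // p p_pr; apply: contraLR; rewrite !inE negbK => t_p.
have [Q sylQ] := Sylow_exists p G.
have sQO : Q \subset 'O_tau(G).
  rewrite tau_core_prod; apply/subsetP=> v Qv.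
  have pv := mem_p_elt (pHall_pgroup sylQ) Qv.
  have Fv : v \in 'C_G[x].
    apply: (pi_elt_normal (pivot_cent_normal S)) pv; last first.
      exact: subsetP (pHall_sub sylQ) v Qv.
    by rewrite index_cent1; apply: pi'_p'nat (pivot_class_tau' S) t_p.
  have sub_p (pi : nat_pred) : p \in pi -> pi.-elt v.
    by move=> pi_p; apply: sub_p_elt pv => r; rewrite !inE => /eqP->.
  move: t_p; rewrite tauE => /orP[s_p | b_p].
    by rewrite (subsetP (mulG_subl _ _)) // (sigma_elt_in_core S) ?sub_p.
  by rewrite (subsetP (mulG_subr _ _)) // (sigma_elt_in_core S') ?sub_p.
rewrite -p'natE //; apply: pnat_dvd (indexgS G sQO) _.
by case/and3P: sylQ.
Qed.

(** On one side G = C_G(P) C_G(O_sigma(G)), so [P, G] centralises O_sigma(G);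
    on the other side P centralises O_beta(G), since C_G(O_beta(G)) is normal
    and its index is an alpha-number. *)
Lemma rho_commutator_pivot_cent (P : {group gT}) p t r :
    p \in rho -> p.-Sylow(G) P -> t \in P -> r \in G -> [~ t, r] \in 'C_G[x].
Proof.
move=> r_p sylP Pt Gr; have [_ defG] := rho_Sylow_norm_cent S r_p sylP.
have Gt := subsetP (pHall_sub sylP) t Pt.
rewrite (pivot_centE S); apply/setIP; split.
  have [_ nF1] := andP (normal_subcent (pcore_normal sigma G)).
  move: Gr; rewrite -{1}defG => /mulsgP[c f /setIP[_ cPc] F1f ->].
  have /eqP tc1 : [~ t, c] == 1 by apply/commgP/commute_sym/(centP cPc).
  rewrite commgMJ tc1 conj1g mulg1 commgEr groupM //.
  by rewrite memJ_norm ?groupV // (subsetP nF1).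
have nsF2 := normal_subcent (pcore_normal beta G).
have F2t : t \in F2.
  apply: (pi_elt_normal nsF2) (mem_p_elt (pHall_pgroup sylP) Pt) => //.
  apply: sub_in_pnat (core_cent_index S') => q _ a_q; rewrite !inE.
  apply: contraTneq a_q => ->; have := sq_disj sq p; rewrite r_p.
  by do !case: (p \in _).
by rewrite commgEl groupM ?groupV // memJ_norm // (subsetP (normal_norm nsF2)).
Qed.

(** For t in P and r in R the commutator [t, r] is central in G, hence a
    p-element, contained in every Sylow p-subgroup of R. Thus R normalises P,
    and N_G(P) = C_G(P). *)
Lemma complement_rho_Sylow_central (R P : {group gT}) p :
    tau^'.-Hall(G) R -> p \in rho -> p.-Sylow(R) P -> P \subset 'Z(R).
Proof.
move=> hallR r_p sylP; have [sRG t'R _] := and3P hallR.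
have sylGP : p.-Sylow(G) P.
  apply: subHall_Sylow hallR _ sylP; rewrite !inE tauE.
  by have := sq_disj sq p; rewrite r_p; do !case: (p \in _).
have [sPR pP _] := and3P sylP.
have nRP : R \subset 'N(P).
  apply/subsetP=> r Rr; rewrite inE; apply/subsetP=> _ /imsetP[t Pt ->].
  have [Gr Rt] := (subsetP sRG r Rr, subsetP sPR t Pt).
  have Rz : [~ t, r] \in R by rewrite groupR.
  have Zz : [~ t, r] \in 'Z(G).
    apply: (pivot_cent_tau'_central S); last exact: mem_p_elt t'R Rz.
    exact: rho_commutator_pivot_cent r_p sylGP Pt Gr.
  have cRz : [~ t, r] \in 'C(R).
    by case/setIP: Zz => _; apply: subsetP; apply: centS.
  have pz : p.-elt [~ t, r].
    have ct : commute t^-1 (t ^ r).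
      rewrite conjg_mulR; apply: commuteM; first exact/commute_sym/commuteV.
      by apply/commute_sym/commuteV; apply: (centP cRz).
    by rewrite commgEl p_eltM // ?p_eltV ?p_eltJ (mem_p_elt pP).
  rewrite conjg_mulR groupM //.
  have : <[[~ t, r]]> \subset 'O_p(R).
    apply: pcore_max => //; rewrite /normal cycle_subG Rz.
    by rewrite cents_norm // centsC cycle_subG.
  by rewrite cycle_subG; apply: subsetP; apply: pcore_sub_Hall.
rewrite subsetI sPR centsC; have [defN _] := rho_Sylow_norm_cent S r_p sylGP.
have : R \subset 'N_G(P) by rewrite subsetI sRG.
by rewrite defN subsetI => /andP[].
Qed.

End Core.

Section Complement.

Variables (rho sigma alpha beta tau : nat_pred) (x : gT).
Hypothesis S : pivot rho sigma alpha beta tau x.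

Let S' := pivot_sym S.
Let sq := pv_sq S.
Let tauE := pv_tau S.
Let F1 := 'C_G('O_sigma(G))%G.
Let F2 := 'C_G('O_beta(G))%G.

Lemma pivot_cent_index : [predU rho & alpha].-nat #|G : 'C_G[x]|.
Proof.
have Gx : x \in G.
  by case/setIP: (pv_x S) => Ox _; rewrite (subsetP (pcore_sub tau G)).
apply/pnatP=> // p p_pr; rewrite index_cent1 => p_dv.
have := pnatP _ (class_size_gt0 _ _) (pivot_class_tau' S) p p_pr p_dv.
have := sq_cover sq Gx p_pr p_dv.
by rewrite !inE tauE; do !case: (p \in _).
Qed.

Variable R : {group gT}.
Hypothesis hallR : tau^'.-Hall(G) R.

Let sRG : R \subset G. Proof. exact: pHall_sub hallR. Qed.

Lemma complement_rest_central r :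
  r \in R -> [predU rho & alpha]^'.-elt r -> r \in 'Z(G).
Proof.
move=> Rr k'r; apply: (pivot_cent_tau'_central S); last first.
  exact: mem_p_elt (pHall_pgroup hallR) Rr.
apply: (pi_elt_normal (pivot_cent_normal S)) k'r; last exact: (subsetP sRG).
by rewrite pnatNK pivot_cent_index.
Qed.

Lemma complement_abelian : abelian R.
Proof.
suffices sRZ : R \subset 'Z(R) by apply: subset_trans sRZ (subsetIr _ _).
rewrite -{1}(Sylow_gen R) gen_subG; apply/bigcupsP=> P /SylowP[p p_pr sylP].
have [r_p | r'p] := boolP (p \in rho).
  exact: (complement_rho_Sylow_central S hallR r_p sylP).
have [a_p | a'p] := boolP (p \in alpha).
  exact: (complement_rho_Sylow_central S' hallR a_p sylP).
have [sPR pP _] := and3P sylP.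
rewrite subsetI sPR; apply/subsetP=> r Pr.
suffices: r \in 'Z(G) by case/setIP=> _; apply: subsetP; apply: centS.
apply: complement_rest_central; first exact: (subsetP sPR).
apply: sub_p_elt (mem_p_elt pP Pr) => q.
by rewrite !inE => /eqP->; rewrite (negPf r'p) (negPf a'p).
Qed.

Lemma tau_core_complement_prod : 'O_tau(G) * R = G.
Proof.
have : R \in [complements to 'O_tau(G) in G].
  by rewrite (compl_pHall _ (tau_core_Hall S)).
by case/complP.
Qed.

Lemma complement_rho_part_cent : 'O_rho(R) \subset 'C('O_beta(G)).
Proof.
apply/subsetP=> r Or; have Gr : r \in G.
  by rewrite (subsetP sRG) // (subsetP (pcore_sub rho R)).
suffices: r \in F2 by case/setIP.
apply: (pi_elt_normal (normal_subcent (pcore_normal beta G))) Gr _; last first.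
  exact: mem_p_elt (pcore_pgroup _ _) Or.
apply: sub_in_pnat (core_cent_index S') => q _ a_q; rewrite !inE.
by have := sq_disj sq q; rewrite a_q; do !case: (q \in _).
Qed.

(** G is generated by O_tau(G), where O_sigma(G) is central, by O_rho(R), and
    by the rho'-elements of R, which centralise O_sigma(G) because the index
    of its centraliser is a rho-number. *)
Lemma cent_complement_rho_part : 'C_('O_sigma(G))('O_rho(R)) \subset 'Z(G).
Proof.
apply/subsetP=> m /setIP[Mm cNm].
have Gm : m \in G by rewrite (subsetP (pcore_sub sigma G)).
rewrite inE Gm -tau_core_complement_prod /= -sub_cent1 mul_subG ?sub_cent1 //.
  have cOM := pcore_cent_core S (fun _ => id).
  by move: m Mm {cNm Gm}; apply/subsetP; rewrite centsC.
apply/centP=> r Rr; have Gr := subsetP sRG r Rr.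
rewrite -(consttC rho r); apply: commuteM.
  apply: (centP cNm); apply: mem_pcore_abelian (p_elt_constt _ _).
    exact: complement_abelian.
  by rewrite groupX.
have : r.`_rho^' \in F1.
  have nsF1 := normal_subcent (pcore_normal sigma G).
  apply: (pi_elt_normal nsF1) (p_elt_constt rho^' r).
    by rewrite pnatNK (core_cent_index S).
  by rewrite groupX.
by case/setIP=> _ /centP/(_ m Mm)/commute_sym.
Qed.

(** A non-central m in O_sigma(G) has a class size that is a rho-number, so it
    is bad for rho and its centraliser acts trivially on O_sigma(G). *)
Lemma complement_semiregular n :
    n \in 'O_rho(R) -> n \notin 'C('O_sigma(G)) ->
  'C_('O_sigma(G))[n] \subset 'Z(G).
Proof.
move=> Nn ncn; apply/subsetP=> m /setIP[Mm cnm].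
have Gm : m \in G by rewrite (subsetP (pcore_sub sigma G)).
have Gn : n \in G by rewrite (subsetP sRG) // (subsetP (pcore_sub rho R)).
apply: contraR ncn => Z'm.
have sF1C : F1 \subset 'C_G[m] by rewrite setIS // -cent_set1 centS // sub1set.
have r_m : rho.-nat #|m ^: G|.
  by apply: (pnat_dvd _ (core_cent_index S)); rewrite -index_cent1 indexgS.
have: ~~ rho^'.-nat #|m ^: G|.
  by apply: contra Z'm => r'm; apply: mem_center => //; apply: pnat_1 r_m r'm.
move/(rho_class_cent_core S Gm)/subsetP/(_ n).
by rewrite inE Gn cent1C cnm => /(_ isT)/setIP[].
Qed.

End Complement.

(** * Building the D-groups *)

(** Here Z(H) is C_N(M), so the elements of N outside Z(H) are those that act
    non-trivially on M; they act without fixed points on M, hence on M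
    Z(H)/Z(H), since M meets Z(H) trivially. *)
Lemma D_groupI M N :
    abelian M -> abelian N -> coprime #|M| #|N| -> N \subset 'N(M) ->
    M :!=: 1 -> 'C_M(N) = 1 ->
    (forall n, n \in N -> n \notin 'C(M) -> 'C_M[n] = 1) ->
  D_group (M <*> N).
Proof.
move=> cMM cNN coMN nMN ntM cMN1 reg.
have defH : M <*> N = M * N by rewrite norm_joinEr.
have tiMN : M :&: N = 1 by rewrite coprime_TIg.
set H := (M <*> N)%G; set Z := 'Z(H)%G.
have sMH : M \subset H by rewrite joing_subl.
have sNH : N \subset H by rewrite joing_subr.
have nsMH : M <| H by rewrite /normal sMH join_subG normG.
have sZN : Z \subset N.
  apply/subsetP=> z /setIP[Hz cz]; move: Hz.
  rewrite /= defH => /mulsgP[m n Mm Nn defz]; rewrite {z}defz in cz *.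
  suffices: m \in 'C_M(N) by rewrite cMN1 => /set1P->; rewrite mul1g.
  rewrite inE Mm; apply/centP=> k Nk.
  have cmnk : commute k (m * n) by apply/esym/(centP cz); rewrite (subsetP sNH).
  have ckn : commute k n by apply: (centsP cNN).
  rewrite -[m](mulgK n); apply/esym/commuteM => //; exact: commuteV.
have Z_cent n : n \in N -> n \in 'C(M) -> n \in Z.
  move=> Nn cMn; rewrite inE (subsetP sNH) //= -sub_cent1 join_subG.
  by rewrite !sub_cent1 cMn (subsetP cNN).
have nZM : M \subset 'N(Z) by rewrite (subset_trans sMH) ?gFnorm.
have nZN : N \subset 'N(Z) by rewrite (subset_trans sNH) ?gFnorm.
exists M, N; split=> //.
rewrite quotientMidr; apply/existsP; exists (N / Z)%G.
have tiMN_Z : M / Z :&: N / Z = 1.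
  by rewrite coprime_TIg // coprime_morph.
apply/Frobenius_semiregularP.
- rewrite sdprodE ?quotient_norms // -quotientMl // -defH //.
- rewrite -subG1 quotient_sub1 //; apply: contra ntM => sMZ.
  by rewrite -subG1 -tiMN subsetI subxx (subset_trans sMZ).
- rewrite -subG1 quotient_sub1 //; apply: contra ntM => sNZ.
  rewrite -cMN1 eq_sym; apply/eqP/setIidPl.
  rewrite centsC (subset_trans sNZ) //.
  by apply: subset_trans (subsetIr _ _) (centS sMH).
move=> x /setD1P[ntx /morphimP[n nZn Nn defx]]; rewrite {x}defx in ntx *.
have ncMn : n \notin 'C(M).
  by apply: contra ntx => cMn; apply/eqP; apply: coset_id (Z_cent n Nn cMn).
apply/trivgP/subsetP=> _ /setIP[/morphimP[m nZm Mm ->] /cent1P cmn].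
have Zmn : [~ m, n] \in Z.
  by apply: coset_idr; rewrite ?groupR // morphR //; apply/eqP/commgP.
have Mmn : [~ m, n] \in M.
  by rewrite commgEl groupM ?groupV // memJ_norm // (subsetP nMN).
have /eqP/commgP/cent1P cnm : [~ m, n] = 1.
  by apply/set1gP; rewrite -tiMN inE Mmn (subsetP sZN).
have : m \in 'C_M[n] by rewrite inE Mm.
by rewrite reg // => /set1P->; rewrite morph1 set11.
Qed.

Lemma coprime_abelian_commg_cent M N :
    N \subset 'N(M) -> coprime #|M| #|N| -> abelian M ->
  [~: M, N] * 'C_M(N) = M /\ (#|[~: M, N]| * #|'C_M(N)|)%N = #|M|.
Proof.
move=> nMN coMN cMM.
have sRM : [~: M, N] \subset M by rewrite commg_subl.
have nRN : N \subset 'N([~: M, N]) by rewrite commg_normr.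
have nRM : M \subset 'N([~: M, N]) by rewrite commg_norml.
have defM : [~: M, N] * 'C_M(N) = M.
  apply/eqP; rewrite eqEsubset mul_subG ?subsetIl //=.
  rewrite -quotientSK //.
  rewrite coprime_quotient_cent ?abelian_sol //.
  by rewrite subsetI subxx quotient_cents2r.
split=> //; rewrite -[in RHS]defM TI_cardMg //.
by rewrite setIA (setIidPl sRM) coprime_abel_cent_TI.
Qed.

Section Pair.

Variables (rho sigma alpha beta tau : nat_pred) (x : gT) (R : {group gT}).
Hypothesis S : pivot rho sigma alpha beta tau x.
Hypothesis hallR : tau^'.-Hall(G) R.

Let sq := pv_sq S.
Let tauE := pv_tau S.
Let sRG : R \subset G. Proof. exact: pHall_sub hallR. Qed.
Let sigma_tau : {subset sigma <= tau}.
Proof. by move=> p; rewrite tauE => ->. Qed.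

Let M1 := 'O_sigma(G)%G.
Let N1 := 'O_rho(R)%G.

Let nMN : N1 \subset 'N(M1).
Proof.
by apply: subset_trans (gFnorm _ _); rewrite (subset_trans (pcore_sub _ _)).
Qed.

Let coMN : coprime #|M1| #|N1|.
Proof.
apply: (pnat_coprime (pcore_pgroup sigma G)).
apply: sub_in_pnat (pcore_pgroup rho R) => p _ r_p; rewrite !inE.
by have := sq_disj sq p; rewrite r_p; do !case: (p \in _).
Qed.

Let cMM : abelian M1.
Proof. by rewrite /abelian (pcore_cent_core S sigma_tau). Qed.

Lemma core_coprime_split :
  [~: M1, N1] * 'C_M1(N1) = M1 /\ (#|[~: M1, N1]| * #|'C_M1(N1)|)%N = #|M1|.
Proof. exact: coprime_abelian_commg_cent. Qed.

(** The fixed points of N1 on O_sigma(G) are central in G and split off: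
    passing to the commutator [M1, N1] leaves a group on which N1 has no fixed
    point. *)
Lemma complement_D_group : D_group ([~: M1, N1] <*> N1).
Proof.
have sRM : [~: M1, N1] \subset M1 by rewrite commg_subl.
have cR1 := coprime_abel_cent_TI nMN coMN cMM.
apply: D_groupI => //.
- exact: abelianS cMM.
- exact: abelianS (pcore_sub _ _) (complement_abelian S hallR).
- exact: coprimeSg coMN.
- by rewrite /= commg_normr.
- apply: contra (core_noncentral S) => /eqP/commG1P cM1N1.
  apply: subset_trans (cent_complement_rho_part S hallR).
  by rewrite subsetI subxx.
move=> n Nn ncn; apply/trivgP/subsetP=> m /setIP[Rm cnm].
rewrite -cR1 inE Rm /=.
have ncn1 : n \notin 'C(M1) by apply: contra ncn; apply: subsetP; apply: centS.
have : m \in 'Z(G).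
  apply: (subsetP (complement_semiregular S hallR Nn ncn1)).
  by rewrite inE (subsetP sRM).
case/setIP=> _; apply: subsetP; apply: centS.
exact: subset_trans (pcore_sub _ _) sRG.
Qed.

Lemma complement_pair_pgroup :
  [predU sigma & rho].-group ([~: M1, N1] <*> N1).
Proof.
have sRM : [~: M1, N1] \subset M1 by rewrite commg_subl.
rewrite /= norm_joinEr ?commg_normr // pgroupM; apply/andP; split.
  apply: sub_in_pnat (pgroupS sRM (pcore_pgroup _ _)) => p _ s_p.
  by rewrite !inE s_p.
by apply: sub_in_pnat (pcore_pgroup rho R) => p _ r_p; rewrite !inE r_p orbT.
Qed.

Lemma card_complement_pair :
  #|[~: M1, N1] <*> N1| <= #|[~: M1, N1]| * #|N1|.
Proof.
rewrite norm_joinEr ?commg_normr // dvdn_leq ?muln_gt0 ?cardG_gt0 //.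
exact: dvdn_cardMg.
Qed.

End Pair.

Section Assemble.

Variables (rho sigma alpha beta tau : nat_pred) (x : gT).
Hypothesis S : pivot rho sigma alpha beta tau x.

(** The factor C collects the central leftovers: the fixed points of N1 and N2
    on the two cores, and the part of R prime to rho and alpha. *)
Lemma pivot_decomposition :
  exists A B C : {group gT},
    [/\ A \x B \x C = G, abelian C, D_group A, D_group B & coprime #|A| #|B|].
Proof.
have S' := pivot_sym S; have sq := pv_sq S; have tauE := pv_tau S.
have /splitsP[R complR] : [splits G, over 'O_tau(G)].
  apply: SchurZassenhaus_split; rewrite ?pcore_normal //.
  exact: pHall_Hall (tau_core_Hall S).
have hallR : tau^'.-Hall(G) R by rewrite -(compl_pHall _ (tau_core_Hall S)).
have sRG := pHall_sub hallR; have cRR := complement_abelian S hallR.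
pose M1 := 'O_sigma(G)%G; pose N1 := 'O_rho(R)%G.
pose M2 := 'O_beta(G)%G; pose N2 := 'O_alpha(R)%G.
pose kappa : nat_pred := [predU rho & alpha].
pose C1 := 'C_M1(N1)%G; pose C2 := 'C_M2(N2)%G; pose C0 := 'O_kappa^'(R)%G.
pose A := ([~: M1, N1] <*> N1)%G; pose B := ([~: M2, N2] <*> N2)%G.
pose C := (C1 <*> C2 <*> C0)%G.
have [defM1 cardM1] :
    [~: M1, N1] * C1 = M1 /\ (#|[~: M1, N1]| * #|C1|)%N = #|M1|.
  exact: core_coprime_split S hallR.
have [defM2 cardM2] :
    [~: M2, N2] * C2 = M2 /\ (#|[~: M2, N2]| * #|C2|)%N = #|M2|.
  exact: core_coprime_split S' hallR.
have sN1R : N1 \subset R := pcore_sub _ _.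
have sN2R : N2 \subset R := pcore_sub _ _.
have sM1G : M1 \subset G := pcore_sub _ _.
have sM2G : M2 \subset G := pcore_sub _ _.
have nM1N1 : N1 \subset 'N(M1).
  by rewrite (subset_trans sN1R) // (subset_trans sRG) ?gFnorm.
have nM2N2 : N2 \subset 'N(M2).
  by rewrite (subset_trans sN2R) // (subset_trans sRG) ?gFnorm.
have sA1 : [~: M1, N1] \subset M1 by rewrite commg_subl.
have sB1 : [~: M2, N2] \subset M2 by rewrite commg_subl.
have sCZ : C \subset 'Z(G).
  rewrite !join_subG (cent_complement_rho_part S hallR).
  rewrite (cent_complement_rho_part S' hallR) /=.
  apply/subsetP=> r C0r; apply: (complement_rest_central S hallR).
    exact: (subsetP (pcore_sub _ _)) C0r.
  exact: mem_p_elt (pcore_pgroup _ _) C0r.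
have sAG : A \subset G.
  by rewrite join_subG (subset_trans sA1) // (subset_trans sN1R).
have sBG : B \subset G.
  by rewrite join_subG (subset_trans sB1) // (subset_trans sN2R).
have cCG H : H \subset G -> C \subset 'C(H).
  move=> sHG; rewrite (subset_trans sCZ) //.
  by rewrite (subset_trans (subsetIr _ _)) ?centS.
have cAB : B \subset 'C(A).
  have cM12 : M2 \subset 'C(M1).
    by apply: (pcore_cent_core S) => p; rewrite tauE orbC => ->.
  rewrite join_subG /A /= !centY !subsetI; apply/andP; split; apply/andP; split.
  - by rewrite (subset_trans sB1) // (subset_trans cM12) ?centS.
  - rewrite (subset_trans sB1) // centsC.
    exact: (complement_rho_part_cent S hallR).
  - by rewrite (subset_trans (complement_rho_part_cent S' hallR)) ?centS.
  by rewrite (subset_trans sN2R) // (subset_trans cRR) ?centS.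
have coAB : coprime #|A| #|B|.
  apply: (@pnat_coprime [predU sigma & rho]).
    exact: complement_pair_pgroup hallR.
  apply: (@sub_in_pnat [predU beta & alpha]); last first.
    exact: complement_pair_pgroup hallR.
  move=> p _; rewrite !inE.
  by have := sq_disj sq p; do !case: (p \in _).
exists A, B, C; split=> //; last first.
- exact: complement_D_group S' hallR.
- exact: complement_D_group S hallR.
- by rewrite /abelian cCG // (subset_trans sCZ) ?subsetIl.
have defAB : A \x B = A <*> B.
  by rewrite dprodE ?coprime_TIg // cent_joinEr.
have sABG : A <*> B \subset G by rewrite join_subG sAG.
have sK : G \subset (A <*> B) <*> C.
  have sAK : A \subset (A <*> B) <*> C by rewrite -joingA joing_subl.
  have sBK : B \subset (A <*> B) <*> C.
    by rewrite [A <*> B]joingC -joingA joing_subl.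
  have sCK : C \subset (A <*> B) <*> C by rewrite joing_subr.
  have [sA1A sN1A] := joing_sub (erefl (A : {set _})).
  have [sB1B sN2B] := joing_sub (erefl (B : {set _})).
  have sC12 : C1 <*> C2 \subset C by rewrite joing_subl.
  have sM1K : M1 \subset (A <*> B) <*> C.
    rewrite -{1}defM1 mul_subG ?(subset_trans sA1A) //.
    exact: subset_trans (subset_trans (joing_subl C1 C2) sC12) sCK.
  have sM2K : M2 \subset (A <*> B) <*> C.
    rewrite -{1}defM2 mul_subG ?(subset_trans sB1B) //.
    exact: subset_trans (subset_trans (joing_subr C1 C2) sC12) sCK.
  rewrite -{1}(tau_core_complement_prod S hallR) (tau_core_prod S).
  rewrite !mul_subG //; apply/subsetP=> r Rr.
  rewrite -(consttC rho r) -(consttC alpha r.`_rho^') !groupM //.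
  + apply: (subsetP sAK); apply: (subsetP sN1A).
    by apply: mem_pcore_abelian (p_elt_constt _ _); rewrite ?groupX.
  + apply: (subsetP sBK); apply: (subsetP sN2B).
    by apply: mem_pcore_abelian (p_elt_constt _ _); rewrite ?groupX.
  apply: (subsetP sCK); rewrite mem_gen // inE; apply/orP; right.
  apply: mem_pcore_abelian; rewrite ?groupX //.
  set t := r.`_rho^'; apply/pnatP=> // p p_pr p_dv; rewrite !inE.
  have := pnatP _ (order_gt0 _) (p_elt_constt alpha^' t) p p_pr p_dv.
  have r't : rho^'.-elt t.`_alpha^' by rewrite p_eltX // p_elt_constt.
  have := pnatP _ (order_gt0 _) r't p p_pr p_dv.
  by rewrite !inE => /negPf-> /negPf->.
have defG : (A <*> B) * C = G.
  apply/eqP; rewrite -cent_joinEr ?cCG // eqEsubset sK andbT join_subG sABG.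
  by rewrite (subset_trans sCZ) ?subsetIl.
(* The product A B C is all of G, and its factors have orders whose product is
   at most |G|, so C meets A B trivially. *)
rewrite defAB dprodE ?cCG //.
apply: cardMg_TI; rewrite defG.
have cardG : #|G| = (#|M1| * #|M2| * #|R|)%N.
  have [tiOR defOR] := complP complR.
  rewrite -defOR TI_cardMg //= (tau_core_prod S) coprime_cardMg //.
  apply: (pnat_coprime (pcore_pgroup sigma G)).
  apply: sub_in_pnat (pcore_pgroup beta G) => p _; rewrite !inE.
  by have := sq_disj sq p; do !case: (p \in _).
have cardR : #|N1| * #|N2| * #|C0| <= #|R|.
  rewrite -(dprod_card (nilpotent_pcoreC kappa (abelian_nil cRR))) leq_mul2r.
  apply/orP; right; rewrite -coprime_cardMg; last first.
    apply: (pnat_coprime (pcore_pgroup rho R)).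
    apply: sub_in_pnat (pcore_pgroup alpha R) => p _; rewrite !inE.
    by have := sq_disj sq p; do !case: (p \in _).
  apply: subset_leq_card; rewrite mul_subG //; apply: sub_pcore => p.
    by rewrite !inE => ->.
  by rewrite !inE orbC => ->.
have cardC : #|C| <= #|C1| * #|C2| * #|C0|.
  have sC12Z : C1 <*> C2 \subset 'C(C0).
    rewrite (subset_trans (subset_trans (joing_subl _ C0) sCZ)) //.
    rewrite (subset_trans (subsetIr _ _)) // centS //.
    by rewrite (subset_trans (pcore_sub _ _)).
  have sC1Z : C1 \subset 'C(C2).
    rewrite (subset_trans (cent_complement_rho_part S hallR)) //.
    by rewrite (subset_trans (subsetIr _ _)) // centS // subIset ?sM2G.
  rewrite /= cent_joinEl // (leq_trans (dvdn_leq _ (dvdn_cardMg _ _))) //.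
    by rewrite muln_gt0 !cardG_gt0.
  rewrite leq_mul2r /= cent_joinEl //; apply/orP; right.
  by rewrite dvdn_leq ?muln_gt0 ?cardG_gt0 // dvdn_cardMg.
have cardAB : #|A <*> B| <= #|A| * #|B|.
  by rewrite cent_joinEr // dvdn_leq ?muln_gt0 ?cardG_gt0 // dvdn_cardMg.
have leA : #|A| <= #|[~: M1, N1]| * #|N1| by apply: card_complement_pair.
have leB : #|B| <= #|[~: M2, N2]| * #|N2| by apply: card_complement_pair.
apply: leq_trans (leq_mul cardAB cardC) _.
apply: leq_trans (leq_mul (leq_mul leA leB) (leqnn _)) _.
rewrite cardG -cardM1 -cardM2; apply: leq_trans (leq_mul (leqnn _) cardR).
apply: eq_leq; rewrite (mulnACA #|[~: M1, N1]|) mulnACA; congr (_ * _)%N.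
by rewrite mulnACA.
Qed.

End Assemble.

End Pivot.

(** * From the graph to the decomposition *)

Section Forward.

Variables (gT : finGroupType) (G : {group gT}).
Implicit Types (pi rho sigma alpha beta tau : nat_pred).

Definition decomposes :=
  exists A B C : {group gT},
    [/\ A \x B \x C = G, abelian C, D_group A, D_group B
      & coprime #|A| #|B|].

Lemma square_max_decomposes rho sigma alpha beta y :
    square_graph G rho sigma alpha beta -> y \in G ->
    (forall z, z \in G -> #|z ^: G| <= #|y ^: G|) ->
    rho^'.-nat #|y ^: G| -> alpha^'.-nat #|y ^: G| ->
  decomposes.
Proof.
move=> sq Gy maxy r'y a'y; pose tau : nat_pred := [predU sigma & beta].
have tauE p : (p \in tau) = (p \in sigma) || (p \in beta) by rewrite inE.
have ty : tau.-nat #|y ^: G|.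
  apply/pnatP=> [|p p_pr p_dv]; first exact: class_size_gt0.
  have := sq_cover sq Gy p_pr p_dv; rewrite tauE.
  have := pnatP _ (class_size_gt0 _ _) r'y p p_pr p_dv.
  have := pnatP _ (class_size_gt0 _ _) a'y p p_pr p_dv.
  by rewrite !inE => /negPf-> /negPf->.
have center z : z \in G ->
    ~~ rho^'.-nat #|z ^: G| -> ~~ alpha^'.-nat #|z ^: G| ->
    z.`_tau^' \in 'Z(G) /\ z.`_tau \in 'Z('O_tau(G)).
  move=> Gz rz az; apply: (small_class_central Gy) => //.
  exact: (bad_class_tau' sq tauE).
have [x Gx [rx ax]] := sq_ra sq; have [Zx ZOx] := center x Gx rx ax.
have eqx : #|x.`_tau ^: G| = #|x ^: G|.
  rewrite -(class_size_centralM x.`_tau Zx).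
  by rewrite -{1}(consttNK tau x) consttC.
apply: (@pivot_decomposition _ _ rho sigma alpha beta tau x.`_tau).
by split; rewrite ?eqx.
Qed.

(** A class of maximal size avoids one set of each of the two pairs; the
    exchanges bring every case to the one where it avoids rho and alpha. *)
Lemma square_decomposes rho sigma alpha beta :
  square_graph G rho sigma alpha beta -> decomposes.
Proof.
move=> sq; have [y Gy maxy] : exists2 y, y \in G &
    forall z, z \in G -> #|z ^: G| <= #|y ^: G|.
  by case: (arg_maxnP (fun z => #|z ^: G|) (group1 G)) => y; exists y.
have swap_ab r s a b : square_graph G r s a b -> square_graph G r s b a.
  by move/square_swap_pairs/square_swap_rs/square_swap_pairs.
have sq_sr := square_swap_rs sq.
have [r'y | s'y] := orP (sq_rs sq Gy); have [a'y | b'y] := orP (sq_ab sq Gy).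
- exact: square_max_decomposes sq Gy maxy r'y a'y.
- exact: square_max_decomposes (swap_ab _ _ _ _ sq) Gy maxy r'y b'y.
- exact: square_max_decomposes sq_sr Gy maxy s'y a'y.
exact: square_max_decomposes (swap_ab _ _ _ _ sq_sr) Gy maxy s'y b'y.
Qed.

Lemma Delta_vertexP p :
  reflect (prime p /\ exists2 x, x \in G & p %| #|x ^: G|)
          (p \in Delta_vertex G).
Proof.
rewrite inE; apply: (iffP andP) => [[-> /existsP[x /andP[]]] | [-> [x Gx px]]].
  by split=> //; exists x.
by split=> //; apply/existsP; exists x; rewrite Gx.
Qed.

Lemma Delta_adjP p q :
  reflect [/\ prime p, prime q, p != q &
             exists2 x, x \in G & (p %| #|x ^: G|) && (q %| #|x ^: G|)]
          (Delta_adj G p q).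
Proof.
apply: (iffP and4P) => [[/Delta_vertexP[p_pr _] /Delta_vertexP[q_pr _]] |].
  move=> neq_pq /existsP[x /andP[Gx pq_dv]]; split=> //; exists x => //.
  by rewrite (dvdn_trans _ pq_dv) ?dvdn_mulr // (dvdn_trans _ pq_dv) ?dvdn_mull.
case=> p_pr q_pr neq_pq [x Gx /andP[p_dv q_dv]].
split=> //; try by apply/Delta_vertexP; split=> //; exists x.
apply/existsP; exists x; rewrite Gx Gauss_dvd ?p_dv //.
by rewrite prime_coprime // dvdn_prime2.
Qed.

Lemma block_square_graph :
  block_square (Delta_vertex G) (Delta_adj G) ->
  exists rho sigma alpha beta, square_graph G rho sigma alpha beta.
Proof.
case=> pi1 [pi2 [pi3 [pi4 [V _ [[d12 d13 d14] [d23 d24 d34]] [n14 n23]]]]].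
case=> e12 e13 e42 e43.
exists [pred p | p \in pi1], [pred p | p \in pi4],
  [pred p | p \in pi2], [pred p | p \in pi3].
have nonadj (piA piB : {pred nat}) : ~ has_edge (Delta_adj G) piA piB ->
    disjoint_preds piA piB -> forall x, x \in G ->
    [pred p | p \in piA]^'.-nat #|x ^: G|
    || [pred p | p \in piB]^'.-nat #|x ^: G|.
  move=> nAB dAB x Gx; apply/norP=> -[].
  case/class_not_p'natP=> p [p_pr p_dv Ap] /class_not_p'natP[q [q_pr q_dv Bq]].
  rewrite !inE in Ap Bq; apply: nAB; exists p, q; split=> //.
  apply/Delta_adjP; split=> //; last by exists x; rewrite ?p_dv.
  by apply: contraPneq (conj Ap Bq) => ->; apply: dAB.
have joint (piA piB : {pred nat}) : has_edge (Delta_adj G) piA piB ->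
    joint_class G [pred p | p \in piA] [pred p | p \in piB].
  case=> p [q [Ap Bq /Delta_adjP[p_pr q_pr _ [x Gx /andP[p_dv q_dv]]]]].
  have bad (pi : nat_pred) r : prime r -> r %| #|x ^: G| -> r \in pi ->
      ~~ pi^'.-nat #|x ^: G|.
    move=> r_pr r_dv pi_r; apply: contraL r_dv => pi'x.
    by rewrite -p'natE // (pi'_p'nat pi'x).
  exists x => //.
  by split; [apply: bad p_dv _ | apply: bad q_dv _]; rewrite ?inE.
split; try exact: joint; try exact: nonadj.
- move=> x p Gx p_pr p_dv.
  have: p \in Delta_vertex G by apply/Delta_vertexP; split=> //; exists x.
  by rewrite V !inE; do !case: (p \in _).
move=> p; rewrite !inE.
have dis (piA piB : {pred nat}) :
    disjoint_preds piA piB -> ~~ ((p \in piA) && (p \in piB)).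
  by move=> dAB; apply/andP=> /dAB.
move: (dis _ _ d12) (dis _ _ d13) (dis _ _ d14).
move: (dis _ _ d23) (dis _ _ d24) (dis _ _ d34).
by do !case: (p \in _).
Qed.

End Forward.

(** * From the decomposition to the graph *)

Section Backward.

Variable gT : finGroupType.
Implicit Types (G H A B C : {group gT}).

Lemma class_size_dprod G A B a b :
  A \x B = G -> a \in A -> b \in B ->
  #|(a * b) ^: G| = (#|a ^: A| * #|b ^: B|)%N.
Proof.
move=> defG Aa Bb; have [_ defAB cAB tiAB] := dprodP defG.
have commAB u v : u \in A -> v \in B -> u * v = v * u.
  by move=> Au Bv; apply/esym/(centsP cAB).
have defC : 'C_G[a * b] = 'C_A[a] * 'C_B[b].
  apply/setP=> g.
  apply/setIP/mulsgP => [[] | [c d /setIP[Ac cac] /setIP[Bd cbd] ->]].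
    rewrite -defAB => /mulsgP[c d Ac Bd ->{g}] /cent1P cg.
    have eq1 : a ^ c * b ^ d = a * b.
      have -> : a ^ c * b ^ d = (a * b) ^ (c * d).
        rewrite conjMg !conjgM; congr (_ * _).
          apply/esym/conjg_fixP/commgP/commAB => //; exact: groupJ.
        by congr (_ ^ _); apply/esym/conjg_fixP/commgP/esym/commAB.
      by apply/conjg_fixP/commgP/esym.
    have eq2 : a^-1 * a ^ c = b * (b ^ d)^-1.
      by apply: (mulgI a); rewrite mulKVg mulgA -eq1 mulgK.
    have t1 : a^-1 * a ^ c \in A :&: B.
      by rewrite inE {2}eq2 !groupM ?groupV ?groupJ.
    rewrite tiAB in t1.
    have ac : a ^ c = a.
      by apply/eqP; rewrite eq_sym eq_mulVg1; apply/eqP/set1gP.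
    have bd : b ^ d = b.
      by apply/eqP; rewrite eq_sym eq_mulgV1 -eq2; apply/eqP/set1gP.
    by exists c d => //; rewrite inE ?Ac ?Bd;
       apply/cent1P/esym/commgP/conjg_fixP.
  split; first by rewrite -defAB mem_mulg.
  apply/cent1P/commuteM; apply/commute_sym/commuteM.
  - by apply/cent1P; rewrite cent1C.
  - exact: commAB.
  - by apply/commute_sym/commAB.
  by apply/cent1P; rewrite cent1C.
have cardC : #|'C_G[a * b]| = (#|'C_A[a]| * #|'C_B[b]|)%N.
  by rewrite defC TI_cardMg //; apply/trivgP; rewrite -tiAB setISS ?subsetIl.
apply/eqP; rewrite -!index_cent1 -(eqn_pmul2l (cardG_gt0 'C_G[a * b])).
rewrite Lagrange ?subsetIl //= cardC mulnACA !Lagrange ?subsetIl //.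
by rewrite -(dprod_card defG).
Qed.

(** Non-trivial elements of M have centraliser M Z because M Z/Z is a
    Frobenius kernel, and multiplying by Z does not change class sizes. An
    element h outside M Z therefore centralises no non-trivial element of M,
    so |M| divides its class size; and its class lies in the coset h M,
    because H/M is abelian. So m is |M| and n is |H : M Z|. *)
Lemma D_group_class_sizes H : D_group H ->
  exists m n, [/\ 1 < m, 1 < n, coprime m n & m * n %| #|H|] /\
   [/\ forall h, h \in H -> #|h ^: H| \in [:: 1; m; n]%N,
       exists2 h, h \in H & #|h ^: H| = m & exists2 h, h \in H & #|h ^: H| = n].
Proof.
case=> M [N [defH [nsMH sNH] [cMM cNN coMN] sZN]].
rewrite quotientMidr; set Z := 'Z(H)%G in sZN |- * => /existsP[Hb frobH].
have [_ ntMZ _ prMZ _] := Frobenius_context frobH.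
have cker := Frobenius_cent1_ker frobH.
have [sMH nMH] := andP nsMH.
have tiMN : M :&: N = 1 by rewrite coprime_TIg.
have tiMZ m : m \in M -> m \in Z -> m = 1.
  by move=> Mm Zm; apply/set1gP; rewrite -tiMN inE Mm (subsetP sZN).
have sZH : Z \subset H := center_sub H.
have cHZ : Z \subset 'C(H) by apply: subsetIr.
have nsZH : Z <| H := center_normal H.
have defMZ : M <*> Z = M * Z.
  by rewrite cent_joinEr // (subset_trans cHZ) ?centS.
have nsZMZ : Z <| M <*> Z.
  by rewrite (normalS _ _ nsZH) ?joing_subr // join_subG sMH.
have mem_MZ h : h \in H -> coset Z h \in M / Z -> h \in M <*> Z.
  move=> Hh; rewrite -quotientMidr -defMZ -{2}(quotientGK nsZMZ) => hb.
  by rewrite mem_morphpre // (subsetP (normal_norm nsZH)).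
have cent_m m : m \in M -> m != 1 -> 'C_H[m] = M <*> Z.
  move=> Mm ntm; apply/eqP; rewrite eqEsubset; apply/andP; split.
    apply/subsetP=> h /setIP[Hh chm]; apply: mem_MZ => //.
    have nZ g : g \in H -> g \in 'N(Z) by apply: subsetP (normal_norm nsZH) g.
    have Hm := subsetP sMH m Mm.
    apply: (subsetP (cker (coset Z m) _)).
      rewrite !inE mem_quotient // andbT.
      apply: contra ntm => /eqP cm1; apply/eqP/tiMZ => //.
      exact: coset_idr (nZ m Hm) cm1.
    rewrite inE mem_quotient //=; apply/cent1P.
    by rewrite /commute -!morphM ?nZ // (cent1P chm).
  have cZH : H \subset 'C(Z) by rewrite centsC.
  rewrite subsetI join_subG sMH sZH /= join_subG; apply/andP; split.
    by rewrite sub_cent1 (subsetP cMM).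
  by rewrite sub_cent1 (subsetP cZH) // (subsetP sMH).
pose n := #|H : M <*> Z|.
have cls_m m : m \in M -> m != 1 -> #|m ^: H| = n.
  by move=> Mm ntm; rewrite -index_cent1 cent_m.
have cls_h h : h \in H -> h \notin M <*> Z -> #|h ^: H| = #|M|.
  move=> Hh MZ'h; apply/eqP; rewrite eqn_leq; apply/andP; split.
    have sH'M : H^`(1) \subset M.
      rewrite der1_min // -defH quotientMidl.
      exact: quotient_abelian.
    rewrite -(card_lcoset M h); apply: subset_leq_card.
    apply/subsetP=> _ /imsetP[g Hg ->]; rewrite mem_lcoset -commgEl.
    by rewrite (subsetP sH'M) // mem_commg.
  have cMh : 'C_M[h] = 1.
    apply/trivgP/subsetP=> m /setIP[Mm cmh]; rewrite inE.
    apply: contraR MZ'h => ntm; rewrite -(cent_m m Mm ntm).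
    by rewrite inE Hh cent1C.
  have := dvdn_class_normal nsMH Hh; rewrite -indexgI /= cMh indexg1.
  by apply: dvdn_leq; apply: class_size_gt0.
have ntM : M :!=: 1.
  by apply: contra ntMZ => /eqP M1; rewrite /= M1 quotient1.
have [m0 Mm0 ntm0] := trivgPn _ ntM.
have [h0 Hh0 MZ'h0] : exists2 h, h \in H & h \notin M <*> Z.
  apply/subsetPn; apply: contraL prMZ => sHMZ; rewrite properE negb_and negbK.
  by apply/orP; right; rewrite /= -(quotientMidr Z M) -defMZ quotientS.
have iHM : #|H : M| = #|N|.
  by rewrite -divgS // -[in X in X %/ _]defH TI_cardMg // mulKn.
exists #|M|, n; split; split.
- by rewrite cardG_gt1.
- by rewrite indexg_gt1; apply/subsetPn; exists h0.
- by apply: coprime_dvdr coMN; rewrite -iHM indexgS // joing_subl.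
- rewrite -(Lagrange (_ : M <*> Z \subset H)) ?join_subG ?sMH //.
  by rewrite dvdn_mul ?cardSg ?joing_subl.
- move=> h Hh; rewrite !inE.
  have [MZh | MZ'h] := boolP (h \in M <*> Z); last first.
    by rewrite cls_h // eqxx orbT.
  move: MZh; rewrite defMZ => /mulsgP[m z Mm Zz ->].
  have -> : m * z = z * m by apply/esym/(centsP cHZ z Zz m (subsetP sMH m Mm)).
  rewrite class_size_centralM //; have [-> | ntm] := eqVneq m 1.
    by rewrite class1G cards1.
  by rewrite cls_m // eqxx !orbT.
- by exists h0; rewrite ?cls_h.
by exists m0; rewrite ?cls_m // (subsetP sMH).
Qed.

Lemma dvdn_class_order G x p : x \in G -> p %| #|x ^: G| -> p %| #|G|.
Proof.
by move=> Gx p_dv; apply: dvdn_trans p_dv _; rewrite -index_cent1 dvdn_indexg.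
Qed.

(** With m1, n1 and m2, n2 the non-trivial class sizes of A and B, the four
    blocks are the prime divisors of m1, m2, n2 and n1, in the order pi1 to
    pi4. Two primes dividing one class size of G and both dividing |A| divide
    one class size of A. *)
Lemma decomposes_block_square G :
  decomposes G -> block_square (Delta_vertex G) (Delta_adj G).
Proof.
case=> A [B [C [defG cCC DA DB coAB]]].
have [m1 [n1 [[m1_gt1 n1_gt1 co1 dv1] [sz1 ex_m1 ex_n1]]]] :=
  D_group_class_sizes DA.
have [m2 [n2 [[m2_gt1 n2_gt1 co2 dv2] [sz2 ex_m2 ex_n2]]]] :=
  D_group_class_sizes DB.
have [AB defAB] : exists AB : {group gT}, A \x B = AB.
  by have [[K L -> _] _ _ _] := dprodP defG; exists K.
rewrite defAB in defG.
have sABG : AB \subset G by have [_ <- _ _] := dprodP defG; rewrite mulG_subl.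
have ABab a b : a \in A -> b \in B -> a * b \in AB.
  by have [_ <- _ _] := dprodP defAB; apply: mem_mulg.
have cls_ab a b : a \in A -> b \in B ->
    #|(a * b) ^: G| = (#|a ^: A| * #|b ^: B|)%N.
  move=> Aa Bb; rewrite -[a * b]mulg1 (class_size_dprod defG) ?ABab //.
  by rewrite class1G cards1 muln1; apply: class_size_dprod.
have Gab a b : a \in A -> b \in B -> a * b \in G.
  by move=> Aa Bb; rewrite (subsetP sABG) ?ABab.
have clsG x : x \in G -> exists a b,
    [/\ a \in A, b \in B & #|x ^: G| = (#|a ^: A| * #|b ^: B|)%N].
  have [_ defG' _ _] := dprodP defG.
  rewrite -{1}defG' => /mulsgP[u c ABu Cc ->].
  have [_ defAB' _ _] := dprodP defAB; move: ABu; rewrite -{1}defAB'.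
  case/mulsgP=> a b Aa Bb ->; exists a, b; split=> //.
  rewrite (class_size_dprod defG) ?ABab // (class_size_dprod defAB) //.
  have Zc : c \in 'Z(C) by rewrite inE Cc (subsetP cCC).
  by rewrite -[c]mulg1 class_size_centralM // class1G cards1 muln1.
have coP p m n : prime p -> coprime m n -> p %| m -> p %| n -> False.
  move=> p_pr co_mn pm pn; have : p %| 1 by rewrite -(eqP co_mn) dvdn_gcd pm.
  by rewrite dvdn1 => /eqP p1; rewrite p1 in p_pr.
have notAB p : prime p -> p %| #|A| -> p %| #|B| -> False.
  by move=> p_pr; apply: coP.
have [m1A n1A] : m1 %| #|A| /\ n1 %| #|A|.
  by split; apply: (dvdn_trans _ dv1); [apply: dvdn_mulr | apply: dvdn_mull].
have [m2B n2B] : m2 %| #|B| /\ n2 %| #|B|.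
  by split; apply: (dvdn_trans _ dv2); [apply: dvdn_mulr | apply: dvdn_mull].
pose P n : {pred nat} := [pred p | prime p && (p %| n)].
have P_gt1 n : 1 < n -> nonempty_pred (P n).
  by move=> n_gt1; exists (pdiv n); rewrite inE pdiv_prime ?pdiv_dvd.
have disj_co m n : coprime m n -> disjoint_preds (P m) (P n).
  move=> co_mn p [/andP[p_pr pm] /andP[_ pn]]; exact: coP p_pr co_mn pm pn.
have coprAB m n : m %| #|A| -> n %| #|B| -> coprime m n.
  by move=> mA nB; apply: coprime_dvdl mA (coprime_dvdr nB coAB).
have dvA p a b : prime p -> p %| #|A| -> b \in B ->
    p %| #|a ^: A| * #|b ^: B| -> p %| #|a ^: A|.
  move=> p_pr pA Bb; rewrite Euclid_dvdM // => /orP[//|pb].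
  by case: (notAB p p_pr pA); apply: dvdn_class_order pb.
have dvB p a b : prime p -> p %| #|B| -> a \in A ->
    p %| #|a ^: A| * #|b ^: B| -> p %| #|b ^: B|.
  move=> p_pr pB Aa; rewrite Euclid_dvdM // => /orP[pa|//].
  by case: (notAB p p_pr _ pB); apply: dvdn_class_order pa.
have no_common c m n p q : c \in [:: 1; m; n]%N -> coprime m n ->
    prime p -> prime q -> p %| m -> q %| n -> p %| c -> q %| c -> False.
  move=> c_in co_mn p_pr q_pr pm qn; move: c_in; rewrite !inE.
  case/or3P=> /eqP-> pc qc.
  - by move: p_pr; rewrite dvdn1 in pc; rewrite (eqP pc).
  - exact: coP q_pr co_mn qc qn.
  exact: coP p_pr co_mn pm pc.
have edge m n : (exists2 a, a \in A & #|a ^: A| = m) ->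
    (exists2 b, b \in B & #|b ^: B| = n) -> 1 < m -> 1 < n ->
    m %| #|A| -> n %| #|B| -> has_edge (Delta_adj G) (P m) (P n).
  move=> [a Aa ca] [b Bb cb] m_gt1 n_gt1 mA nB.
  have [p_pr q_pr] := (pdiv_prime m_gt1, pdiv_prime n_gt1).
  exists (pdiv m), (pdiv n); split; rewrite ?inE ?p_pr ?q_pr ?pdiv_dvd //.
  apply/Delta_adjP; split=> //.
    apply/eqP=> eq_pq; apply: (notAB (pdiv m) p_pr).
      exact: dvdn_trans (pdiv_dvd _) mA.
    by rewrite eq_pq; apply: dvdn_trans (pdiv_dvd _) nB.
  exists (a * b); first exact: Gab.
  by rewrite cls_ab // ca cb dvdn_mulr ?pdiv_dvd // dvdn_mull ?pdiv_dvd.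
exists (P m1), (P m2), (P n2), (P n1); split.
- move=> p; rewrite !inE; apply/andP/idP => [[p_pr /existsP[x /andP[Gx]]] |].
    have [a [b [Aa Bb ->]]] := clsG x Gx.
    rewrite p_pr Euclid_dvdM //= => /orP[].
      have := sz1 a Aa; rewrite !inE => /or3P[] /eqP->; last 2 first.
      + by move->.
      + by move->; rewrite !orbT.
      by rewrite dvdn1 => /eqP p1; rewrite p1 in p_pr.
    have := sz2 b Bb; rewrite !inE => /or3P[] /eqP->; last 2 first.
    + by move->; rewrite !orbT.
    + by move->; rewrite !orbT.
    by rewrite dvdn1 => /eqP p1; rewrite p1 in p_pr.
  have vert a b : a \in A -> b \in B -> p %| #|a ^: A| * #|b ^: B| ->
      [exists x in G, p %| #|x ^: G|].
    by move=> Aa Bb p_dv; apply/existsP; exists (a * b); rewrite Gab ?cls_ab.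
  have [a1 Aa1 cls_a1] := ex_m1; have [a1' Aa1' cls_a1'] := ex_n1.
  have [b1 Bb1 cls_b1] := ex_m2; have [b1' Bb1' cls_b1'] := ex_n2.
  case/or4P=> /andP[p_pr p_dv]; split=> //.
  + by apply: (vert a1 b1) => //; rewrite cls_a1 dvdn_mulr.
  + by apply: (vert a1 b1) => //; rewrite cls_b1 dvdn_mull.
  + by apply: (vert a1 b1') => //; rewrite cls_b1' dvdn_mull.
  by apply: (vert a1' b1) => //; rewrite cls_a1' dvdn_mulr.
- by split; apply: P_gt1.
- split; split; apply: disj_co => //; try exact: coprAB.
  + by rewrite coprime_sym coprAB.
  by rewrite coprime_sym coprAB.
- split=> -[p [q [/andP[p_pr pm] /andP[q_pr qn] /Delta_adjP[_ _ _ [x Gx]]]]].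
    have [a [b [Aa Bb ->]]] := clsG x Gx => /andP[p_dv q_dv].
    apply: (no_common _ _ _ p q (sz1 a Aa)) => //.
      exact: dvA p_pr (dvdn_trans pm m1A) Bb p_dv.
    exact: dvA q_pr (dvdn_trans qn n1A) Bb q_dv.
  have [a [b [Aa Bb ->]]] := clsG x Gx => /andP[p_dv q_dv].
  apply: (no_common _ _ _ p q (sz2 b Bb)) => //.
    exact: dvB p_pr (dvdn_trans pm m2B) Aa p_dv.
  exact: dvB q_pr (dvdn_trans qn n2B) Aa q_dv.
by split; apply: edge.
Qed.

End Backward.

Theorem theoremA (gT : finGroupType) (G : {group gT}) :
  block_square (Delta_vertex G) (Delta_adj G) <->
  exists A B C : {group gT},
    [/\ A \x B \x C = G, abelian C, D_group A, D_group B
      & coprime #|A| #|B|].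
Proof.
split; last exact: decomposes_block_square.
case/block_square_graph=> rho [sigma [alpha [beta sq]]].
exact: square_decomposes sq.
Qed.
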